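(* Consider a nontrivial $m$-cycle of $C$, with $K$ odd elements and $L$ even elements. Assume there is a positive integer $m_2$ with $m_2\leq m$ and $\frac{\delta^{m_2}-1}{\delta-1}\cdot\frac{\log\left(\frac{162}{97}X_0\right)}{\log 2}\leq\frac{m_2}{m}\cdot K.$ Let $v=\frac{m_2}{m}\cdot K\cdot\frac{\delta-1}{\delta^{m_2}-1}$. Then $\delta<\frac{K+L}{K}<\delta+\frac{1}{K\cdot 3\log(2)}\left(\frac{97(m-m_2)+73}{54X_0}+\frac{3}{2^v-1}+\frac{3(m_2-1)}{(2^v-1)^{\delta}}\right).$ If $m_2=m-1$, then moreover $\delta<\frac{K+L}{K}<\delta+\frac{1}{K\cdot 3\log(2)}\left(\frac{3}{X_0}+\frac{3}{2^v-1}+\frac{3(m-2)}{(2^v-1)^{\delta}}\right),$ and if $m_2=m$, then $\delta<\frac{K+L}{K}<\delta+\frac{1}{K\cdot 3\log(2)}\left(\frac{3}{2^v-1}+\frac{3(m-1)}{(2^v-1)^{\delta}}\right).$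
   Context: $C(n)=n/2$ for even $n$, $C(n)=(3n+1)/2$ for odd $n$ (on positive integers). A nontrivial cycle is a set $\{n,C(n),\dots,C^{p-1}(n)\}$ with $C^p(n)=n$, different from $\{1,2\}$. A local minimum of the cycle is an element smaller than its predecessor and successor along the cycle. An $m$-cycle is a nontrivial cycle with exactly $m$ local minima. $\delta:=\frac{\log 3}{\log 2}$. $X_0$ is a positive integer with $X_0>765$ such that for every positive integer $n\leq X_0$ the sequence $n,C(n),C^2(n),\dots$ eventually reaches $1$. *)

(* Defs.v *)
From mathcomp Require Import all_boot all_order all_algebra finmap.
From mathcomp Require Import all_classical all_reals all_analysis.
Set Implicit Arguments.
Unset Strict Implicit.
Unset Printing Implicit Defensive.
Import Order.TTheory GRing.Theory Num.Theory.

Local Open Scope fset_scope.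
Local Open Scope nat_scope.

(* The accelerated Collatz map; only its values at positive integers matter.
   [n./2] is exact in both branches. *)
Definition collatz (n : nat) : nat :=
  if odd n then (3 * n).+1./2 else n./2.

Definition collatz_cycle (A : {fset nat}) : Prop :=
  exists n p : nat,
    [/\ 0 < n, 0 < p, iter p collatz n = n
      & A = [fset iter i collatz n | i in iota 0 p]].

Definition nontrivial_cycle (A : {fset nat}) : Prop :=
  collatz_cycle A /\ A <> [fset 1; 2].

(* [collatz] permutes a cycle [A], so the predecessor of [x] along [A] is the
   unique [y] in [A] with [collatz y = x]; the quantifier ranges over it. *)
Definition local_min (A : {fset nat}) (x : nat) : bool :=
  [&& x \in A, x < collatz x
    & [forall y : A, (collatz (val y) == x) ==> (x < val y)]].

Definition m_cycle (m : nat) (A : {fset nat}) : Prop :=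
  nontrivial_cycle A /\ #|` [fset x in A | local_min A x]| = m.

Definition odd_elements (A : {fset nat}) : {fset nat} := [fset x in A | odd x].

Definition even_elements (A : {fset nat}) : {fset nat} :=
  [fset x in A | ~~ odd x].

Definition collatz_verified (X0 : nat) : Prop :=
  forall n : nat, 0 < n <= X0 -> exists k : nat, iter k collatz n = 1.

Definition delta (R : realType) : R := (ln 3 / ln 2)%R.

(* Main.v *)
Require Import Defs.
From mathcomp Require Import all_boot all_order all_algebra finmap.
From mathcomp Require Import ring lra zify.
Set Implicit Arguments.
Unset Strict Implicit.
Unset Printing Implicit Defensive.
Import Order.TTheory GRing.Theory Num.Theory.

(* Every cycle element exceeds [X0].  Multiplying [collatz x / x]
   around the cycle gives [(K + L) ln 2 = K ln 3 + \sum ln (1 + 1 / (3 y))],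
   summed over the odd elements [y], so everything reduces to bounding the sum
   of the inverses of the odd elements.  A local minimum [x] starts a run of
   [k] odd elements with sum at most [3 (1 - (2/3)^k) / x], and, writing
   [x + 1 = a 2^k], the run ends at [a 3^k - 1]; hence [u x = ln (x + 1)]
   grows by a factor at most [delta] from one local minimum to the next.

   If [a 3^k - 1] is halved more than once before the next local minimum, then
   [(x - 1) / 2] runs into the cycle too, so that [2 X0 < x].  Consequently a
   run with sum above [97 / (54 X0)] has [3 <= k], is halved only once, has
   [u x < ln (162/97 X0)], and can be paired with one of the next two runs so
   that the average of the pair is at most [97 / (54 X0)].

   Since [u] grows at most by [delta] along the cycle, the sorted values of [u]
   also have consecutive ratios at most [delta], whereas their sum is at least
   [K ln 2].  Convexity of [1 / (e^t - 1)] then makes the geometric progression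
   [v ln 2, delta v ln 2, ...] the worst case for the [m2] largest of them.  For
   the mixed bound the [m2] largest are taken outside the pairs, except for a
   single partner that keeps the ratios below [delta]; only that one pair is
   broken, which costs less than the extra [73 / (54 X0)]. *)

Local Open Scope fset_scope.
Local Open Scope nat_scope.

(** * Runs of the Collatz map *)

(** In terms of [n + 1] an odd step is multiplication by 3/2, which is why runs are described
    through [x.+1]. *)
Lemma collatz_double_pred c : 0 < c -> collatz (2 * c).-1 = (3 * c).-1.
Proof. by case: c => // c _; rewrite /collatz; case: ifP; lia. Qed.

Lemma collatz_double c : collatz (2 * c) = c.
Proof. by rewrite /collatz; case: ifP; lia. Qed.

Lemma collatz_oddE n : odd n -> 2 * collatz n = 3 * n + 1.
Proof. by move=> o; rewrite /collatz o; lia. Qed.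

Lemma collatz_evenE n : ~~ odd n -> 2 * collatz n = n.
Proof. by rewrite /collatz; case: ifP; lia. Qed.

Lemma iter_collatz_gt0 n r : 0 < n -> 0 < iter r collatz n.
Proof.
move=> n0; elim: r => //= r IH.
by case: (boolP (odd (iter r collatz n))) => [/collatz_oddE|/collatz_evenE]; lia.
Qed.

Lemma iter_collatz_run a k j : 0 < a -> j <= k ->
  iter j collatz (a * 2 ^ k).-1 = (a * 3 ^ j * 2 ^ (k - j)).-1.
Proof.
move=> a0; elim: j => [|j IH] jk; first by rewrite muln1 subn0.
have -> : iter j.+1 collatz (a * 2 ^ k).-1 =
  collatz (2 * (a * 3 ^ j * 2 ^ (k - j.+1))).-1.
  by rewrite iterS IH ?(ltnW jk)// -(subnSK jk) expnS mulnCA.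
by rewrite collatz_double_pred ?muln_gt0 ?a0 ?expn_gt0// expnS; congr _.-1; lia.
Qed.

Lemma iter_collatz_halve a l : iter l collatz (2 ^ l * a) = a.
Proof. by elim: l => [|l IH]; rewrite ?mul1n// iterSr expnS -mulnA collatz_double. Qed.

(** [ones x] counts the trailing binary ones of [x], which is the number of odd steps before the
    first even value, [peak x]. [next_min x] is the odd part of that value; for a local minimum [x]
    of a cycle it is the following local minimum. *)
Definition ones x := logn 2 x.+1.
Definition oddpart x := x.+1 %/ 2 ^ ones x.
Definition peak x := (oddpart x * 3 ^ ones x).-1.
Definition next_min x := peak x %/ 2 ^ logn 2 (peak x).

Lemma succ_oddpart x : x.+1 = oddpart x * 2 ^ ones x.
Proof. by rewrite divnK// pfactor_dvdnn. Qed.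

Lemma odd_oddpart x : odd (oddpart x).
Proof.
rewrite -coprime2n.
have [a ca e] := pfactor_coprime (isT : prime 2) (ltn0Sn x).
by rewrite /oddpart {1}e /ones mulnK ?expn_gt0.
Qed.

Lemma oddpart_gt0 x : 0 < oddpart x.
Proof. by case: oddpart (odd_oddpart x). Qed.

Lemma iter_onesE x j : j <= ones x ->
  iter j collatz x = (oddpart x * 3 ^ j * 2 ^ (ones x - j)).-1.
Proof.
by move=> jk; rewrite -iter_collatz_run ?oddpart_gt0// -succ_oddpart.
Qed.

Lemma iter_onesM x j : j <= ones x -> 2 ^ j * (iter j collatz x).+1 = 3 ^ j * x.+1.
Proof.
move=> jk; rewrite iter_onesE// prednK ?muln_gt0 ?oddpart_gt0 ?expn_gt0//.
have -> : x.+1 = oddpart x * (2 ^ j * 2 ^ (ones x - j)).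
  by rewrite -expnD subnKC -?succ_oddpart.
by lia.
Qed.

Lemma iter_ones_odd x j : j < ones x -> odd (iter j collatz x).
Proof.
move=> jk; rewrite iter_onesE ?(ltnW jk)// -(subnSK jk) expnS.
have := oddpart_gt0 x; have : 0 < 3 ^ j by rewrite expn_gt0.
have : 0 < 2 ^ (ones x - j.+1) by rewrite expn_gt0.
set a := 2 ^ _; set b := 3 ^ _; set c := oddpart x => a0 b0 c0.
have : 0 < c * b * a by rewrite !muln_gt0 a0 b0 c0.
by rewrite mulnCA; set d := c * b * a; lia.
Qed.

Lemma iter_ones_peak x : iter (ones x) collatz x = peak x.
Proof. by rewrite iter_onesE// subnn muln1. Qed.

Lemma succ_peak x : (peak x).+1 = oddpart x * 3 ^ ones x.
Proof. by rewrite prednK// muln_gt0 oddpart_gt0 expn_gt0. Qed.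

Lemma peak_even x : ~~ odd (peak x).
Proof. by rewrite -oddS succ_peak oddM oddX odd_oddpart orbT. Qed.

Lemma ones_gt0 x : odd x -> 0 < ones x.
Proof. by move=> ox; rewrite logn_gt0 mem_primes /= dvdn2 /= ox. Qed.

Lemma peak_gt0 x : odd x -> 0 < peak x.
Proof.
move=> ox; have := succ_peak x; have := oddpart_gt0 x.
have : 3 <= 3 ^ ones x by rewrite -{1}(expn1 3) leq_exp2l// ones_gt0.
by nia.
Qed.

Lemma logn_peak_gt0 x : odd x -> 0 < logn 2 (peak x).
Proof. by move=> ox; rewrite logn_gt0 mem_primes /= peak_gt0// dvdn2 peak_even. Qed.

Lemma peak_next x : peak x = 2 ^ logn 2 (peak x) * next_min x.
Proof. by rewrite mulnC divnK// pfactor_dvdnn. Qed.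

Lemma iter_next_min x : iter (logn 2 (peak x) + ones x) collatz x = next_min x.
Proof. by rewrite iterD iter_ones_peak {2}peak_next iter_collatz_halve. Qed.

Lemma next_min_odd x : odd x -> odd (next_min x).
Proof.
move=> /peak_gt0 p0; rewrite -coprime2n.
have [a ca e] := pfactor_coprime (isT : prime 2) p0.
by rewrite /next_min {1}e mulnK ?expn_gt0.
Qed.

Lemma iter_peak_even x i : i < logn 2 (peak x) -> ~~ odd (iter i collatz (peak x)).
Proof.
move=> il; rewrite {1}peak_next -(subnKC (ltnW il)) expnD -mulnA iter_collatz_halve.
by rewrite -(subnSK il) expnS -mulnA oddM.
Qed.

(** * Cycles and their local minima *)

(** Positivity, closure and transitivity replace the chosen generator and period from here on. *)
Lemma collatz_cycleP A : collatz_cycle A ->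
  [/\ forall x, x \in A -> 0 < x, forall x r, x \in A -> iter r collatz x \in A
    & forall x y, x \in A -> y \in A -> exists r, iter r collatz x = y].
Proof.
case=> n [p [n0 p0 pn ->]].
have memA x : reflect (exists2 i, i < p & x = iter i collatz n)
    (x \in [fset iter i collatz n | i in iota 0 p]).
  apply: (iffP (imfsetP _ _ _ _)) => /= -[i].
    by rewrite mem_iota => ip ->; exists i.
  by move=> ip ->; exists i => //; rewrite mem_iota.
split.
- by move=> x /memA[i _ ->]; apply: iter_collatz_gt0.
- move=> x r /memA[i _ ->]; apply/memA; exists ((r + i) %% p); first by rewrite ltn_mod.
  rewrite -iterD {1}(divn_eq (r + i) p) addnC iterD; congr iter.
  by elim: (_ %/ _) => // q IH; rewrite mulSn iterD IH.
- move=> x y /memA[i ip ->] /memA[j jp ->]; exists (j + (p - i)).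
  by rewrite -iterD -addnA subnK ?(ltnW ip)// iterD pn.
Qed.

(** [x] and [y] return to themselves after [q.+1] and [s.+1] steps. After the product of the two
    periods both have returned, while their orbits agree from the first step on. *)
Lemma collatz_cycle_inj A : collatz_cycle A -> {in A &, injective collatz}.
Proof.
move=> /collatz_cycleP[_ iA oA] x y xA yA e.
have per z : z \in A -> exists q, iter q.+1 collatz z = z.
  move=> zA; have [q qz] := oA _ z (iA z 1 zA) zA.
  by exists q; rewrite iterSr.
have [q qx] := per x xA; have [s sy] := per y yA.
have itx a : iter (a * q.+1) collatz x = x.
  by elim: a => // a IH; rewrite mulSn iterD IH.
have ity a : iter (a * s.+1) collatz y = y.
  by elim: a => // a IH; rewrite mulSn iterD IH.
have := itx s.+1; rewrite mulSn addSn iterSr e -iterSr -addSn -mulSn.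
by rewrite mulnC ity.
Qed.

Lemma iter_inj_in A r : collatz_cycle A -> {in A &, injective (iter r collatz)}.
Proof.
move=> cA; have [_ iA _] := collatz_cycleP cA.
elim: r => //= r IH x y xA yA e; apply: IH => //.
by apply: (collatz_cycle_inj cA); rewrite // iA.
Qed.

Lemma trivial_orbit r : iter r collatz 1 \in [fset 1; 2].
Proof. by elim: r => [|r]; rewrite ?inE//= => /orP[]/eqP->. Qed.

Lemma nontrivial_notin1 A : nontrivial_cycle A -> 1 \notin A.
Proof.
move=> [cA nA]; apply/negP => A1; apply: nA; have [_ iA oA] := collatz_cycleP cA.
apply/fsetP => x; apply/idP/idP => [/(oA 1 x A1)[r <-]|]; first exact: trivial_orbit.
by rewrite !inE => /orP[]/eqP-> //; apply: (iA 1 1).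
Qed.

(** If [z <= X0], the orbit of [z] passes through 1, so the cycle it enters meets the orbit of 1 and
    contains 1. The point [z] may lie outside the cycle and merely merge into it. *)
Lemma reach_cycle_gt X0 A z j : collatz_verified X0 -> nontrivial_cycle A ->
  0 < z -> iter j collatz z \in A -> X0 < z.
Proof.
move=> ver ntA z0 zA; rewrite ltnNge; apply/negP => zX.
have [k k1] := ver z ltac:(by rewrite z0 zX).
have [_ iA _] := collatz_cycleP ntA.1.
have := iA _ k zA; rewrite -iterD addnC iterD k1.
have := nontrivial_notin1 ntA.
have := trivial_orbit j; rewrite !inE => /orP[]/eqP-> N1 A2; first by rewrite A2 in N1.
by have := iA _ 1 A2; rewrite /= (negPf N1).
Qed.

Definition local_mins A := [fset x in A | local_min A x].

(** An odd [y] has [collatz y > y], so a predecessor above [x] is even and equals [2 * x]; and only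
    an odd [x] has a larger successor. *)
Lemma local_minP A x : collatz_cycle A ->
  reflect (exists2 y, y \in A & y = 2 * x /\ odd x) (x \in local_mins A).
Proof.
move=> cA; have [pA iA oA] := collatz_cycleP cA.
rewrite !inE /= /local_min; apply: (iffP and3P) => [[xA _ /andP[xC /forallP m]]|].
  have ox : odd x by apply: contraTT xC => /collatz_evenE; have := pA _ xA; lia.
  have [r rx] := oA _ _ (iA x 1 xA) xA.
  have yA := iA x r xA; have Cy : collatz (iter r collatz x) = x.
    by rewrite -iterS iterSr.
  have := m [` yA]; rewrite /= Cy eqxx /= => xy.
  exists (iter r collatz x) => //; split=> //.
  have [/collatz_oddE|/collatz_evenE] := boolP (odd (iter r collatz x)); lia.
move=> [y yA [e ox]]; have xA : x \in A.
  by have := iA y 1 yA; rewrite e /= collatz_double.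
split=> //.
have := collatz_oddE ox; have := pA _ xA => x0 Cx; apply/andP; split; first by lia.
apply/forallP => -[z zA] /=; apply/implyP => /eqP Cz.
have -> : z = y by apply: (collatz_cycle_inj cA) => //; rewrite Cz e collatz_double.
by lia.
Qed.

Lemma local_min_mem A x : x \in local_mins A -> x \in A.
Proof. by rewrite !inE => /andP[]. Qed.

Lemma local_min_odd A x : collatz_cycle A -> x \in local_mins A -> odd x.
Proof. by move=> cA /(local_minP _ cA)[y _ []]. Qed.

Lemma next_min_local A x : collatz_cycle A -> x \in local_mins A ->
  next_min x \in local_mins A.
Proof.
move=> cA xM; have ox := local_min_odd cA xM; have xA := local_min_mem xM.
have [_ iA _] := collatz_cycleP cA.
apply/(local_minP _ cA); exists (2 * next_min x); last by rewrite next_min_odd.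
have pA : peak x \in A by rewrite -iter_ones_peak iA.
have /prednK e := logn_peak_gt0 ox.
suff <- : iter (logn 2 (peak x)).-1 collatz (peak x) = 2 * next_min x by exact: iA.
by rewrite {2}peak_next -{2}e expnSr -mulnA iter_collatz_halve.
Qed.

(** Up to the peak the predecessors are odd, whereas a local minimum is preceded by its double; on
    the descent the elements themselves are even. *)
Lemma run_not_local_min A x r : collatz_cycle A -> x \in local_mins A ->
  0 < r < logn 2 (peak x) + ones x -> iter r collatz x \notin local_mins A.
Proof.
move=> cA xM /andP[r0 rl]; have [_ iA _] := collatz_cycleP cA.
have xA := local_min_mem xM.
apply/negP => /(local_minP _ cA)[y yA [ey od]].
have yE : y = iter r.-1 collatz x.
  apply: (collatz_cycle_inj cA) => //; first exact: iA.
  by rewrite -iterS prednK// ey collatz_double.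
have [rk|kr] := leqP r (ones x).
  have : odd y by rewrite yE iter_ones_odd// prednK.
  by rewrite ey oddM.
have := @iter_peak_even x (r - ones x) ltac:(lia).
by rewrite -iter_ones_peak -iterD subnK ?(ltnW kr)// od.
Qed.

(** If two runs of lengths [a <= b] end at the same point, injectivity of [collatz] puts the start
    of the shorter on the longer one, whose only local minimum before its end is its start. *)
Lemma next_min_inj A : collatz_cycle A -> {in local_mins A &, injective next_min}.
Proof.
move=> cA x y xM yM; have [_ iA _] := collatz_cycleP cA.
rewrite -!iter_next_min.
wlog: x y xM yM / logn 2 (peak x) + ones x <= logn 2 (peak y) + ones y.
  move=> H e; have [le|/ltnW le] := leqP (logn 2 (peak x) + ones x) (logn 2 (peak y) + ones y).
    exact: H.
  exact/esym/H.
set a := (X in X <= _); set b := (X in _ <= X) => ab e.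
have xE : x = iter (b - a) collatz y.
  have yA := local_min_mem yM; apply: (@iter_inj_in A a cA _ _ (local_min_mem xM) (iA _ _ yA)).
  by rewrite -iterD (subnKC ab); exact: e.
have [ba0|ba0] := posnP (b - a); first by rewrite xE ba0.
have a0 : 0 < a by have := ones_gt0 (local_min_odd cA xM); rewrite /a; lia.
have ba : 0 < b - a < b by rewrite ba0 -subn_gt0 subKn.
by have := run_not_local_min cA yM ba; rewrite -xE xM.
Qed.

Lemma next_min_connect A x y : collatz_cycle A -> x \in local_mins A ->
  y \in local_mins A -> exists q, iter q next_min x = y.
Proof.
move=> cA xM yM; have [_ _ oA] := collatz_cycleP cA.
have [r] := oA x y (local_min_mem xM) (local_min_mem yM).
elim/ltn_ind: r x xM => r IH x xM rE.
have [r0|r0] := posnP r; first by exists 0; rewrite -rE r0.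
have kx := ones_gt0 (local_min_odd cA xM).
have [rl|lr] := ltnP r (logn 2 (peak x) + ones x).
  by have := @run_not_local_min A x r cA xM; rewrite r0 rl rE yM => /(_ isT).
have [||q qE] := IH (r - (logn 2 (peak x) + ones x)) _ (next_min x) (next_min_local cA xM).
- by lia.
- by rewrite -iter_next_min -iterD subnK.
- by exists q.+1; rewrite iterSr.
Qed.

(** Going back through odd elements strictly decreases them, so the search stops at an element with
    an even predecessor, which is a local minimum. *)
Lemma odd_in_run A y : collatz_cycle A -> y \in A -> odd y ->
  exists2 x, x \in local_mins A & exists2 j, j < ones x & iter j collatz x = y.
Proof.
move=> cA; have [pA iA oA] := collatz_cycleP cA.
elim/ltn_ind: y => y IH yA oy.
have [r ry] := oA _ _ (iA y 1 yA) yA.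
have [z zA Cz] : exists2 z, z \in A & collatz z = y.
  by exists (iter r collatz y); [exact: iA|rewrite -iterS iterSr].
have [oz|ez] := boolP (odd z).
  have zy : z < y by have := collatz_oddE oz; lia.
  have [x xM [j jk jE]] := IH z zy zA oz; exists x => //; exists j.+1; last by rewrite iterS jE.
  rewrite ltn_neqAle jk andbT; apply/eqP => e.
  by have := peak_even x; rewrite -iter_ones_peak -e iterS jE Cz oy.
exists y; last by exists 0; rewrite ?ones_gt0.
by apply/(local_minP _ cA); exists z => //; split=> //; rewrite -Cz collatz_evenE.
Qed.

(* A double halving lets the run starting at [(x - 1) / 2] merge with the cycle. *)
Lemma halve_twice_gt X0 A x : collatz_verified X0 -> nontrivial_cycle A ->
  x \in local_mins A -> 1 < logn 2 (peak x) -> 2 * X0 < x.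
Proof.
move=> ver ntA xM l2; have cA := ntA.1; have [pA iA _] := collatz_cycleP cA.
have xA := local_min_mem xM; have ox := local_min_odd cA xM.
have x1 : x != 1 by apply: contraNneq (nontrivial_notin1 ntA) => <-.
have k0 := ones_gt0 ox.
have zA : iter 2 collatz (peak x) \in A by rewrite -iter_ones_peak -iterD iA.
have zE : peak x = 4 * iter 2 collatz (peak x).
  by rewrite {2}peak_next -(subnKC l2) expnD -mulnA iter_collatz_halve {1}peak_next -{1}(subnKC l2) expnD -mulnA.
have sE := succ_oddpart x; have pE := succ_peak x.
move: k0 sE pE zE zA; case ek : (ones x) => [//|k] _.
have := odd_oddpart x; have := oddpart_gt0 x; move: (oddpart x) => a a0 oa.
move: (iter 2 _ _) => z sE pE zE zA; rewrite !expnS in sE pE.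
have z0 := pA _ zA.
(* [(a * 2 ^ k).-1] is [(x - 1) / 2]; it makes one odd step fewer than [x]. *)
have wE : iter k collatz (a * 2 ^ k).-1 = (a * 3 ^ k).-1.
  by rewrite iter_collatz_run// subnn muln1.
suff : X0 < (a * 2 ^ k).-1 by lia.
apply: (@reach_cycle_gt X0 A _ (k + 2)) => //; first by lia.
rewrite addnC iterD wE.
move: (a * 3 ^ k) (mulnCA a 3 (3 ^ k)) => t tE; rewrite tE in pE.
(* [3 * t = 4 * z + 1] gives [3 * h + 1 = 2 * z] for [h = (t - 1) / 2], so [h] is odd and
   [collatz h = z]: the two orbits merge. *)
have -> : t.-1 = 2 * (t.-1)./2 by lia.
rewrite iterSr collatz_double /=.
suff -> : collatz (t.-1)./2 = z by [].
have : odd (t.-1)./2 by lia.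
by move=> /collatz_oddE; lia.
Qed.

Local Close Scope fset_scope.
Local Open Scope ring_scope.

(** * Sums over the largest values *)

(** Every further term is at least each of the first [a], so the mean cannot drop. *)
Lemma geometric_sum_mean (R : realFieldType) (d : R) (a b : nat) :
  1 <= d -> (a <= b)%N ->
  b%:R * \sum_(i < a) d ^+ i <= a%:R * \sum_(i < b) d ^+ i.
Proof.
move=> d1 /subnKC <-; elim: (b - a)%N => [|k IH]; first by rewrite addn0.
rewrite addnS big_ord_recr /= mulrDr -natr1 mulrDl mul1r lerD//.
rewrite mulr_natl -[X in _ *+ X]card_ord -sumr_const; apply: ler_sum => i _.
by rewrite ler_weXn2l// (leq_trans (ltnW (ltn_ord i)))// leq_addr.
Qed.

(* Past the first term either all [t j] are at least [d * v], or all of them are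
   below the geometric progression [d ^+ j * v]; in the second case their
   deficits are paid for by [t 0]. *)
Lemma ratio_bounded_sum (R : realFieldType) (n : nat) (t : nat -> R)
    (d v0 v lam gd : R) (g : R -> R) :
  (0 < n)%N -> 1 < d -> 0 < v0 -> v0 <= v -> 0 <= lam ->
  (forall j, (j.+1 < n)%N -> t j <= t j.+1 <= d * Num.max (t j) v0) ->
  v * \sum_(j < n) d ^+ j <= \sum_(j < n) t j ->
  (forall x, v <= x -> g x <= gd + lam * Num.max 0 (d * v - x)) ->
  \sum_(j < n) g (t j) <= n%:R * gd + lam * (d * v - v).
Proof.
case: n => // n _ d1 v00 v0v lam0 tP sumt gP.
have v_gt0 : 0 < v by apply: lt_le_trans v0v.
have d_gt0 : 0 < d by lra.
have dX j : v <= d ^+ j * v by rewrite ler_peMl ?(ltW v_gt0)// exprn_ege1// ltW.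
have step j x : (j.+1 < n.+1)%N -> t j <= d ^+ x * v -> t j.+1 <= d ^+ x.+1 * v.
  move=> /tP/andP[_ h] h2; apply: (le_trans h).
  by rewrite exprS -mulrA ler_pM2l// ge_max h2 (le_trans v0v).
have grow i j : (j + i < n.+1)%N -> t j <= d ^+ j * v -> t (j + i)%N <= d ^+ (j + i) * v.
  move=> + tj; elim: i => [|i IH] ji; first by rewrite addn0.
  by rewrite addnS in ji *; apply: step => //; apply: IH (ltnW ji).
have mono i j : (j + i < n.+1)%N -> t j <= t (j + i)%N.
  elim: i => [|i IH] ji; first by rewrite addn0.
  rewrite addnS in ji *; apply: (le_trans (IH (ltnW ji))).
  by have /andP[] := tP _ ji.
(* Otherwise every [t j] is at most [d ^+ j * v], strictly for [j = 0], against the lower bound on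
   the sum. *)
have t0 : v <= t 0%N.
  rewrite leNgt; apply/negP => tv.
  move: sumt; rewrite leNgt => /negP; apply.
  rewrite !big_ord_recl /= mulrDr expr0 mulr1 ltr_leD// mulr_sumr ler_sum// => i _.
  rewrite mulrC; apply: (grow (bump 0 i) 0%N); first exact: (ltn_ord (lift ord0 i)).
  by rewrite expr0 mul1r ltW.
have tv (j : 'I_n.+1) : v <= t j by apply: (le_trans t0); apply: (mono j 0%N (ltn_ord j)).
suff dfc : \sum_(j < n.+1) Num.max 0 (d * v - t j) <= d * v - v.
  apply: (@le_trans _ _ (\sum_(j < n.+1) (gd + lam * Num.max 0 (d * v - t j)))).
    by apply: ler_sum => j _; apply: gP.
  by rewrite big_split /= sumr_const card_ord -[gd *+ _]mulr_natl lerD2l -mulr_sumr ler_wpM2l.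
have e0 : Num.max 0 (d * v - t 0%N) <= d * v - v.
  by rewrite ge_max lerB// andbT subr_ge0 ler_peMl// ltW.
case: n tP sumt step grow mono tv => [|n] tP sumt step grow mono tv; first by rewrite big_ord1.
have [t1|t1] := leP (d * v) (t 1%N).
  rewrite big_ord_recl big1 ?addr0// => i _.
  rewrite max_l// subr_le0 (le_trans t1)//.
  by rewrite (mono i 1%N)// (ltn_ord (lift ord0 i)).
have t01 : t 0%N <= t 1%N by have /andP[] := tP 0%N isT.
rewrite big_ord_recl /= max_r; last by lra.
apply: (@le_trans _ _ (d * v - t 0%N +
    \sum_(i < n.+1) (v * d ^+ (bump 0 i) - t (bump 0 i)))).
  rewrite lerD2l ler_sum// => i _.
  have h : t (bump 0 i) <= d ^+ (bump 0 i) * v.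
    by apply: (grow i 1%N); [exact: (ltn_ord (lift ord0 i))|rewrite expr1 ltW].
  rewrite [v * _]mulrC ge_max subr_ge0; apply/andP; split; first exact: h.
  by rewrite lerB// /bump /= add1n exprS -mulrA ler_pM2l.
rewrite sumrB -mulr_sumr.
(* By [sumt], what the later terms lack in total against the progression is at most [t 0 - v]. *)
by move: sumt; rewrite big_ord_recl [leRHS]big_ord_recl /= expr0 mulrDr mulr1; lra.
Qed.

Lemma sorted_top (R : realFieldType) (I : finType) (u : I -> R) (Q : {set I})
    (n : nat) (x0 : I) : (n <= #|Q|)%N ->
  exists s : seq I, [/\ size s = n, uniq s, {subset s <= Q},
    forall i j, (i <= j < n)%N -> u (nth x0 s i) <= u (nth x0 s j)
    & forall x y, x \in s -> y \in Q -> y \notin s -> u y <= u x].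
Proof.
move=> nQ; pose r x y := u x <= u y.
have rtot : total r by move=> x y; rewrite /r; apply: le_total.
have rtr : transitive r by move=> x y z; apply: le_trans.
pose e := sort r (enum Q); pose s := drop (#|Q| - n) e.
have es : sorted r e by apply: sort_sorted.
have ee : e = take (#|Q| - n) e ++ s by rewrite cat_take_drop.
have ue : uniq e by rewrite sort_uniq enum_uniq.
have memE y : (y \in e) = (y \in Q) by rewrite mem_sort mem_enum.
have ss : size s = n by rewrite size_drop size_sort -cardE subKn.
exists s; split => //.
- by rewrite drop_uniq.
- by move=> x xs; rewrite -memE ee mem_cat xs orbT.
- move=> i j /andP[ij jn].
  have srt : sorted r s by rewrite drop_sorted.
  have refl : reflexive r by move=> x; apply: lexx.
  by apply: (sorted_leq_nth rtr refl x0 srt) => //; rewrite inE ss// (leq_ltn_trans ij).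
- move=> x y xs; rewrite -memE ee mem_cat => /orP[yt _|->//].
  move: es; rewrite ee (sorted_pairwise rtr) pairwise_cat => /and3P[/allrelP h _ _].
  exact: h.
Qed.

(** The values of [u] above the threshold [v0] have no multiplicative gap wider than [d]. The
    threshold allows elements with smaller values to be removed from [Q]. *)
Definition ratio_linked (R : realFieldType) (I : finType) (u : I -> R)
    (Q : {set I}) (d v0 : R) :=
  forall t x y, v0 <= t -> x \in Q -> y \in Q -> u x <= t -> t < u y ->
    exists2 z, z \in Q & t < u z <= d * t.

(** A larger jump would, by [ratio_linked] at the maximum of the current value and [v0], put an
    element of [Q] strictly between two consecutive top values. *)
Lemma sorted_ratio (R : realFieldType) (I : finType) (u : I -> R) (Q : {set I})
    (d v0 : R) (n : nat) (x0 : I) (s : seq I) :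
  1 < d -> 0 < v0 -> ratio_linked u Q d v0 ->
  size s = n -> {subset s <= Q} ->
  (forall i j, (i <= j < n)%N -> u (nth x0 s i) <= u (nth x0 s j)) ->
  (forall x y, x \in s -> y \in Q -> y \notin s -> u y <= u x) ->
  forall j, (j.+1 < n)%N ->
    u (nth x0 s j) <= u (nth x0 s j.+1) <= d * Num.max (u (nth x0 s j)) v0.
Proof.
move=> d1 v00 rl ss sQ mono top j jn; rewrite mono ?leqnSn//= leNgt; apply/negP.
set t := Num.max _ _ => tlt.
have jn' : (j < n)%N by apply: ltnW.
have xt : u (nth x0 s j) <= t by rewrite le_max lexx.
have v0t : v0 <= t by rewrite le_max lexx orbT.
have t_gt0 : 0 < t by apply: lt_le_trans v0t.
have tdt : t <= d * t by rewrite ler_peMl// ltW.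
have xs : nth x0 s j \in s by rewrite mem_nth ?ss.
have ys : nth x0 s j.+1 \in s by rewrite mem_nth ?ss.
have [z zQ /andP[tz zt]] := rl t _ _ v0t (sQ _ xs) (sQ _ ys) xt (le_lt_trans tdt tlt).
have [zs|/(top _ _ xs zQ)] := boolP (z \in s); last first.
  by move=> zx; move: (lt_le_trans tz (le_trans zx xt)); rewrite ltxx.
have in_ : (index z s < n)%N by rewrite -ss index_mem.
have [ij|ji] := leqP (index z s) j.
  have := mono (index z s) j; rewrite ij jn' nth_index// => /(_ isT) zx.
  by move: (lt_le_trans tz (le_trans zx xt)); rewrite ltxx.
have := mono j.+1 (index z s); rewrite ji in_ nth_index// => /(_ isT) yz.
by move: (lt_le_trans tlt (le_trans yz zt)); rewrite ltxx.
Qed.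

(** The mean of the [n] largest values is at least the mean over [Q], so the lower bound on the sum
    passes to them and [ratio_bounded_sum] applies. *)
Lemma top_subset_bound (R : realFieldType) (I : finType) (u : I -> R)
    (Q : {set I}) (n : nat) (d v0 v lam gd : R) (g : R -> R) :
  (0 < n)%N -> (n <= #|Q|)%N -> 1 < d -> 0 < v0 -> v0 <= v -> 0 <= lam ->
  ratio_linked u Q d v0 ->
  #|Q|%:R * (v * \sum_(j < n) d ^+ j) <= n%:R * \sum_(x in Q) u x ->
  (forall x, v <= x -> g x <= gd + lam * Num.max 0 (d * v - x)) ->
  exists T : {set I}, [/\ T \subset Q, #|T| = n &
    \sum_(x in T) g (u x) <= n%:R * gd + lam * (d * v - v)].
Proof.
move=> n0 nQ d1 v00 v0v lam0 rl sumQ gP.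
have /card_gt0P[x0 x0Q] : (0 < #|Q|)%N by apply: leq_trans nQ.
have [s [ss us sQ mono top]] := sorted_top u x0 nQ.
have sT F : \sum_(x in [set x in s]) F x = \sum_(j < n) F (nth x0 s j) :> R.
  rewrite (eq_bigl (mem s)) => [|x]; last by rewrite inE.
  by rewrite -big_uniq// (big_nth x0) ss big_mkord.
exists [set x in s]; split.
- by apply/subsetP => x; rewrite inE => /sQ.
- by rewrite cardsE (card_uniqP us).
rewrite sT; apply: (ratio_bounded_sum n0 d1 v00 v0v lam0 (t := fun j => u (nth x0 s j))) => //.
  exact: sorted_ratio d1 v00 rl ss sQ mono top.
rewrite -(sT u).
have n_gt0 : 0 < n%:R :> R by rewrite ltr0n.
have Q_gt0 : 0 < #|Q|%:R :> R by rewrite ltr0n (leq_trans n0).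
rewrite -(ler_pM2l Q_gt0) (le_trans sumQ)//.
set b := u (nth x0 s 0).
have bs x : x \in s -> b <= u x.
  by move=> xs; rewrite -(nth_index x0 xs) mono// -ss index_mem.
have TQ : [set x in s] \subset Q by apply/subsetP => x; rewrite inE => /sQ.
rewrite [X in _ * X <= _](big_setID [set x in s]) /= (setIidPr TQ).
have cT : #|[set x in s]| = n by rewrite cardsE (card_uniqP us).
have hT : n%:R * b <= \sum_(x in [set x in s]) u x.
  rewrite -cT mulr_natl -sumr_const; apply: ler_sum => x; rewrite inE; exact: bs.
have hQ : \sum_(x in Q :\: [set x in s]) u x <= (#|Q| - n)%:R * b.
  have -> : (#|Q| - n)%N = #|Q :\: [set x in s]| by rewrite cardsD (setIidPr TQ) cT.
  rewrite mulr_natl -sumr_const; apply: ler_sum => x.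
  by rewrite !inE => /andP[xs xQ]; apply: top => //; rewrite mem_nth// ss.
rewrite natrB// in hQ.
have {}nQ : n%:R <= #|Q|%:R :> R by rewrite ler_nat.
set ST := \sum_(x in [set x in s]) u x in hT *.
set SQ := \sum_(x in Q :\: _) u x in hQ *.
by nra.
Qed.

(** Sorted increasingly, the values start at or below [d * v0] because of [w] and then grow by at
    most [d] each; the added [v0] is the zeroth term of the progression. *)
Lemma chain_sum_bound (R : realFieldType) (I : finType) (u : I -> R)
    (Q : {set I}) (d v0 : R) (w : I) :
  1 < d -> 0 < v0 -> ratio_linked u Q d v0 -> w \in Q -> u w <= d * v0 ->
  v0 + \sum_(x in Q) u x <= v0 * \sum_(j < #|Q|.+1) d ^+ j.
Proof.
move=> d1 v00 rl wQ uw.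
have [s [ss us sQ mono top]] := sorted_top u w (leqnn #|Q|).
have ratio := sorted_ratio d1 v00 rl ss sQ mono top.
have sE : s =i Q.
  have sQ' : {subset s <= enum Q} by move=> x /sQ; rewrite mem_enum.
  have [|_ h x] := uniq_min_size us sQ'; first by rewrite ss -cardE.
  by rewrite h mem_enum.
rewrite -(eq_bigl _ _ sE) -big_uniq// (big_nth w) ss big_mkord.
rewrite big_ord_recl expr0 mulrDr mulr1 lerD2l mulr_sumr; apply: ler_sum => -[j /= jQ] _.
rewrite /bump add1n; elim: j jQ => [|j IH] jQ.
  rewrite expr1 mulrC (le_trans _ uw)// -[X in _ <= u X](nth_index w (_ : w \in s)) ?sE//.
  by rewrite mono//= -ss index_mem sE.
have /andP[_ h] := ratio _ jQ; rewrite (le_trans h)// exprS mulrCA ler_pM2l ?(lt_trans ltr01)//.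
by rewrite ge_max IH ?(ltnW jQ)//= ler_peMr ?(ltW v00)// exprn_ege1// ltW.
Qed.

(** Only elements of [D] exceed [c], and each is compensated by its own partner unless that partner
    lies in [T]. By injectivity only one element has partner [w], so at most one excess [e]
    remains. *)
Lemma paired_excess (R : realFieldType) (I : finType) (S : I -> R) (p : I -> I)
    (c e : R) (T : {set I}) (w : I) :
  let D := [set x | c < S x] in
  0 <= e -> (forall x, S x <= c + e) ->
  {in D &, injective p} -> (forall x, x \in D -> p x \notin D) ->
  (forall x, x \in D -> S x + S (p x) <= 2 * c) ->
  [disjoint T & D] -> (forall x, x \in D -> p x \in T -> p x = w) ->
  \sum_(x in ~: T) S x <= #|~: T|%:R * c + e.
Proof.
move=> D e0 Se pinj pD pS TD Tw.
have DT x : x \in D -> x \notin T by move=> xD; rewrite (disjointFl TD).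
rewrite addrC -lerBlDr mulr_natl -sumr_const -sumrB.
pose D2 := [set x in D | p x != w].
have D2D : D2 \subset D by apply/subsetP => x; rewrite inE => /andP[].
have ZT : D :|: p @: D2 \subset ~: T.
  apply/subsetP => x; rewrite !inE => /orP[xD|/imsetP[y]]; first by rewrite DT// inE.
  by rewrite inE => /andP[yD yw] ->; apply/negP => /(Tw _ yD)/eqP; rewrite (negPf yw).
have Zdis : [disjoint D & p @: D2].
  rewrite disjoint_sym; apply/pred0P => x /=; apply/negP => /andP[/imsetP[y yD2 ->]].
  by apply/negP/pD/(subsetP D2D).
rewrite (big_setID (D :|: p @: D2)) /= (setIidPr ZT).
apply: (@le_trans _ _ (\sum_(x in D :|: p @: D2) (S x - c))).
  rewrite gerDl; apply: sumr_le0 => x; rewrite !inE negb_or => /andP[/andP[xD _] _].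
  by rewrite subr_le0 leNgt.
rewrite (eq_bigl [predU D & p @: D2]) => [|x]; last by rewrite !inE.
rewrite bigU//= big_imset /=; last first.
  by move=> x y /(subsetP D2D) xD /(subsetP D2D) yD; apply: pinj.
rewrite (big_setID D2) /= (setIidPr D2D) addrAC -big_split /=.
apply: (@le_trans _ _ (\sum_(x in D :\: D2) (S x - c))).
  rewrite gerDr; apply: sumr_le0 => x /(subsetP D2D)/pS; lra.
apply: (@le_trans _ _ (\sum_(x in D :\: D2) e)).
  by apply: ler_sum => x _; rewrite lerBlDl.
rewrite sumr_const; suff : (#|D :\: D2| <= 1)%N.
  by case: #|_| => [|[|]].
apply/card_le1_eqP => x y; rewrite !inE.
move=> /andP[+ xD] /andP[+ yD]; rewrite xD yD /= !negbK => /eqP xw /eqP yw.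
by apply: pinj; rewrite ?inE ?xD ?yD// xw yw.
Qed.

Lemma top_sum_bound (R : realFieldType) (I : finType) (u S : I -> R)
    (n : nat) (d v0 v lam gd b : R) (g : R -> R) :
  (0 < n)%N -> (n <= #|I|)%N -> 1 < d -> 0 < v0 -> v0 <= v -> 0 <= lam ->
  ratio_linked u [set: I] d v0 ->
  #|I|%:R * (v * \sum_(j < n) d ^+ j) <= n%:R * \sum_x u x ->
  (forall x, v <= x -> g x <= gd + lam * Num.max 0 (d * v - x)) ->
  (forall x, S x <= g (u x)) -> (forall x, S x <= b) ->
  \sum_x S x <= (#|I|%:R - n%:R) * b + (n%:R * gd + lam * (d * v - v)).
Proof.
move=> n0 nI d1 v00 v0v lam0 rl sumu gP Sg Sb.
have sumT : \sum_(x in [set: I]) u x = \sum_x u x by apply: eq_bigl => x; rewrite inE.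
have := @top_subset_bound R I u [set: I] n d v0 v lam gd g.
rewrite cardsT sumT => /(_ n0 nI d1 v00 v0v lam0 rl sumu gP)[T [_ cT gT]].
have cC : #|~: T| = (#|I| - n)%N by rewrite cardsCs setCK cT.
rewrite (bigID (mem T)) /= addrC lerD//.
  rewrite (eq_bigl _ _ (fun x => esym (in_setC x T))).
  by rewrite -natrB// mulr_natl -cC -sumr_const; apply: ler_sum.
by apply: le_trans gT; apply: ler_sum.
Qed.

(** Unless [D] is empty or [n = 1], the top [n] are taken from [Q], the elements outside [D] and its
    partners, with one partner kept. A removed pair contributes at most [v0 + d * v0], no more than
    twice the mean of the progression, so the mean over [Q] stays large enough. *)
Lemma paired_sum_bound (R : realFieldType) (I : finType) (u S : I -> R)
    (p : I -> I) (n : nat) (d v0 v lam gd c e : R) (g : R -> R) :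
  let D := [set x | c < S x] in
  (0 < n)%N -> (n <= #|I|)%N -> 1 < d -> 0 < v0 -> v0 <= v -> 0 <= lam ->
  ratio_linked u [set: I] d v0 ->
  #|I|%:R * (v * \sum_(j < n) d ^+ j) <= n%:R * \sum_x u x ->
  (forall x, v <= x -> g x <= gd + lam * Num.max 0 (d * v - x)) ->
  (forall x, S x <= g (u x)) ->
  0 <= e -> (forall x, S x <= c + e) ->
  {in D &, injective p} -> (forall x, x \in D -> p x \notin D) ->
  (forall x, x \in D -> S x + S (p x) <= 2 * c) ->
  (forall x, x \in D -> u x < v0) -> (forall x, x \in D -> u (p x) <= d * v0) ->
  \sum_x S x <= (#|I|%:R - n%:R) * c + e + (n%:R * gd + lam * (d * v - v)).
Proof.
move=> D n0 nI d1 v00 v0v lam0 rl sumu gP Sg e0 Se pinj pD pS Dv0 pv0.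
have v_gt0 : 0 < v by apply: lt_le_trans v0v.
suff [T [w [cT TD Tw gT]]] : exists T : {set I}, exists w, [/\ #|T| = n,
    [disjoint T & D], forall x, x \in D -> p x \in T -> p x = w
    & \sum_(x in T) g (u x) <= n%:R * gd + lam * (d * v - v)].
  have := paired_excess e0 Se pinj pD pS TD Tw.
  have -> : #|~: T| = (#|I| - n)%N by rewrite cardsCs setCK cT.
  rewrite natrB// => h; rewrite (bigID (mem T)) /= addrC lerD//.
    by rewrite (eq_bigl _ _ (fun x => esym (in_setC x T))).
  by apply: le_trans gT; apply: ler_sum.
have [x0 _] : exists x0 : I, x0 \in I by apply/card_gt0P; apply: leq_trans nI.
have sumT : \sum_(x in [set: I]) u x = \sum_x u x by apply: eq_bigl => x; rewrite inE.
have [D0|D0] := eqVneq D set0.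
  have := @top_subset_bound R I u [set: I] n d v0 v lam gd g.
  rewrite cardsT sumT => /(_ n0 nI d1 v00 v0v lam0 rl sumu gP)[T [_ cT gT]].
  exists T, x0; split=> //; first by rewrite D0 disjoint_sym; apply/pred0P => x /=; rewrite inE.
  by move=> x; rewrite D0 inE.
have /set0Pn[d0 d0D] := D0.
have nI_gt0 : 0 < #|I|%:R :> R by rewrite ltr0n (leq_trans n0).
case: (ltngtP n 1) n0 => // [n1|n1] _; last first.
  (* For [n = 1] a maximiser of [u] suffices: its value is at least the mean, hence at least [v0],
     so it is not in [D]. *)
  pose y := [arg max_(i > x0) u i]%O.
  have uy x : u x <= u y by rewrite /y; case: arg_maxP => // i _; apply.
  have vy : v <= u y.
    move: sumu; rewrite n1 big_ord1 expr0 mulr1 mul1r => h.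
    rewrite -(ler_pM2l nI_gt0) (le_trans h)// mulr_natl -sumr_const; exact: ler_sum.
  exists [set y], y; split.
  - by rewrite cards1 n1.
  - rewrite disjoints1; apply/negP => /Dv0; rewrite ltNge => /negP; apply.
    exact: le_trans vy.
  - by move=> x _; rewrite inE => /eqP.
  - rewrite big_set1 n1 mul1r (le_trans (gP _ vy))// lerD2l ler_wpM2l// ge_max.
    by rewrite lerB// subr_ge0 ler_peMl ?(ltW v_gt0)// ltW.
(* [w], the partner with the largest [u], stays available so that gaps in the
   values of [u] over [Q] are never wider than a factor [d]. *)
pose dm := [arg max_(i > d0 in D) u (p i)]%O; pose w := p dm.
have [dmD uw] : dm \in D /\ forall x, x \in D -> u (p x) <= u w.
  by rewrite /w /dm; case: arg_maxP => // i iD h; split=> // x; apply: h.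
have uwd : u w <= d * v0 by apply: pv0.
pose P := p @: (D :\ dm); pose Q := ~: (D :|: P).
have DP : [disjoint D & P].
  rewrite disjoint_sym; apply/pred0P => x /=; apply/negP => /andP[/imsetP[y]].
  by rewrite in_setD1 => /andP[_ yD] ->; apply/negP/pD.
have wP : w \notin P.
  apply/imsetP => -[y]; rewrite in_setD1 => /andP[ym yD] /(pinj _ _ dmD yD) e1.
  by rewrite e1 eqxx in ym.
have wQ : w \in Q by rewrite !in_setC in_setU negb_or wP pD.
have pPw x : x \in D -> p x \in Q -> p x = w.
  move=> xD; rewrite in_setC in_setU negb_or => /andP[_ h]; congr p; apply/eqP.
  by apply: contraR h => xm; apply/imset_f; rewrite in_setD1 xm.
have rlQ : ratio_linked u Q d v0.
  move=> t x y v0t xQ yQ xt ty.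
  have [z _ /andP[tz zt]] := rl t x y v0t (in_setT _) (in_setT _) xt ty.
  have [zQ|] := boolP (z \in Q); first by exists z; rewrite ?tz.
  rewrite in_setC negbK in_setU => /orP[/Dv0 zv|/imsetP[i]].
    by move: (lt_trans tz zv); rewrite ltNge v0t.
  rewrite in_setD1 => /andP[_ iD] ze; exists w => //.
  rewrite (lt_le_trans tz) ?ze ?uw//= (le_trans uwd)//.
  by rewrite ler_pM2l// (lt_trans ltr01).
pose q := #|D|.-1.
have cD : #|D| = q.+1 by rewrite prednK//; apply/card_gt0P; exists d0.
have cP : #|P| = q.
  rewrite card_in_imset ?(cardsD1 dm D) in cD *; last first.
    by move=> x y; rewrite !in_setD1 => /andP[_ xD] /andP[_ yD]; apply: pinj.
  by move: cD; rewrite dmD add1n => -[].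
have cI : #|I| = (#|Q| + (q.+1 + q))%N.
  by rewrite -(cardsC (D :|: P)) addnC cardsU cD cP (disjoint_setI0 DP) cards0 subn0.
have sumI : \sum_x u x < \sum_(x in Q) u x + (q.+1%:R * v0 + q%:R * (d * v0)).
  rewrite (bigID (mem Q)) /= ltrD2l (eq_bigl [predU D & P]) => [|x]; last first.
    by rewrite !inE negbK.
  rewrite bigU//= ltr_leD//.
    rewrite -cD mulr_natl -sumr_const; apply: ltr_sum => [|x xD]; last exact: Dv0.
    by apply/hasP; exists d0; rewrite ?mem_index_enum.
  rewrite -cP mulr_natl -sumr_const; apply: ler_sum => x /imsetP[i].
  by rewrite in_setD1 => /andP[_ iD] ->; apply: pv0.
set U := \sum_(x in Q) u x in sumI.
set G := \sum_(j < n) d ^+ j in sumu.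
have n_gt0 : 0 < n%:R :> R by rewrite ltr0n ltnW.
have G2 : n%:R * (1 + d) <= 2 * G.
  have := @geometric_sum_mean R d 2 n (ltW d1) n1.
  by rewrite !big_ord_recl big_ord0 expr0 addr0.
have Gn : n%:R <= G.
  have := @geometric_sum_mean R d 1 n (ltW d1) (ltnW n1).
  by rewrite big_ord1 expr0 mulr1 mul1r.
have q0 : 0 <= q%:R :> R by rewrite ler0n.
have cI' : #|I|%:R = #|Q|%:R + 1 + 2 * q%:R :> R.
  by rewrite cI !natrD -natr1; ring.
have key : (#|Q|%:R + 1) * (v * G) < n%:R * (U + v0).
  have h1 : n%:R * \sum_x u x < n%:R * (U + (q.+1%:R * v0 + q%:R * (d * v0))).
    by rewrite ltr_pM2l.
  rewrite -natr1 in h1; rewrite cI' in sumu.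
  have h2 : q%:R * v0 * (n%:R * (1 + d)) <= q%:R * v0 * (2 * G).
    by apply: ler_wpM2l => //; rewrite mulr_ge0// ltW.
  have h3 : q%:R * (2 * G) * v0 <= q%:R * (2 * G) * v.
    by apply: ler_wpM2l => //; rewrite !mulr_ge0// (le_trans _ Gn)// ltW.
  by lra.
(* With fewer than [n] elements, [Q] and the extra [v0] would sum to at most a progression starting
   at [v0], too little for [key]. *)
have nQ : (n <= #|Q|)%N.
  rewrite leqNgt; apply/negP => Qn.
  have h := chain_sum_bound d1 v00 rlQ wQ uwd.
  have h2 := geometric_sum_mean (ltW d1) Qn; rewrite -natr1 -/G in h2.
  set GQ := \sum_(j < _) _ in h h2.
  have h3 : n%:R * (v0 + U) <= n%:R * (v0 * GQ) by rewrite ler_pM2l.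
  have h4 : v0 * (n%:R * GQ) <= v0 * ((#|Q|%:R + 1) * G) by rewrite ler_pM2l.
  have h5 : (#|Q|%:R + 1) * G * v0 <= (#|Q|%:R + 1) * G * v.
    by apply: ler_wpM2l => //; rewrite mulr_ge0 ?addr_ge0 ?ler0n// (le_trans _ Gn)// ltW.
  by lra.
have sumQ : #|Q|%:R * (v * G) <= n%:R * U.
  have : n%:R * v0 <= G * v by apply: ler_pM => //; exact: ltW.
  by lra.
have [T [TQ cT gT]] := top_subset_bound (ltnW n1) nQ d1 v00 v0v lam0 rlQ sumQ gP.
exists T, w; split=> //.
- apply/pred0P => x /=; apply/negP => /andP[/(subsetP TQ)].
  by rewrite in_setC in_setU negb_or => /andP[/negP].
- by move=> x xD /(subsetP TQ); apply: pPw.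
Qed.

From mathcomp Require Import all_classical all_reals all_analysis.

(** * Analytic estimates *)

(** Convexity of [1 / (exp t - 1)] as a tangent inequality: after [exp (t - a) >= 1 + t - a] the
    difference is a square over a positive product. *)
Lemma inv_expR_tangent (R : realType) (a t : R) : 0 < a -> 0 < t ->
  (expR t - 1)^-1 - expR t / (expR t - 1) ^+ 2 * (a - t) <= (expR a - 1)^-1.
Proof.
move=> a0 t0.
have A1 : 1 < expR a by rewrite expR_gt1.
have T1 : 1 < expR t by rewrite expR_gt1.
have := expR_ge1Dx (t - a); rewrite expRB.
move: (expR a) (expR t) A1 T1 => A T A1 T1 h.
have {}h : (A - T) / A <= a - t.
  by rewrite mulrBl divff ?gt_eqF ?(lt_trans ltr01)//; lra.
have A0 : A != 0 by rewrite gt_eqF// (lt_trans ltr01).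
have A10 : A - 1 != 0 by rewrite gt_eqF// subr_gt0.
have T10 : T - 1 != 0 by rewrite gt_eqF// subr_gt0.
apply: (@le_trans _ _ ((T - 1)^-1 - T / (T - 1) ^+ 2 * ((A - T) / A))).
  rewrite lerD2l lerN2 ler_wpM2l// divr_ge0 ?sqr_ge0//; lra.
rewrite -subr_ge0.
have -> : (A - 1)^-1 - ((T - 1)^-1 - T / (T - 1) ^+ 2 * ((A - T) / A)) =
    (T - A) ^+ 2 / ((A - 1) * (T - 1) ^+ 2 * A).
  by field; rewrite A0 A10 T10.
by rewrite divr_ge0 ?sqr_ge0// !mulr_ge0 ?sqr_ge0//; lra.
Qed.

(** Up to [d * v] the chord bound follows from the tangent at [x] evaluated at both ends; beyond,
    monotonicity suffices. The maximum merges the two cases. *)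
Lemma inv_expR_chord (R : realType) (v d x : R) : 0 < v -> 1 < d -> v <= x ->
  (expR x - 1)^-1 <= (expR (d * v) - 1)^-1 +
    ((expR v - 1)^-1 - (expR (d * v) - 1)^-1) / (d * v - v)
      * Num.max 0 (d * v - x).
Proof.
move=> v0 d1 vx.
have vdv : v < d * v by rewrite ltr_pMl.
have x0 : 0 < x by apply: lt_le_trans vx.
have [dvx|xdv] := leP (d * v) x.
  rewrite max_l; last by lra.
  rewrite mulr0 addr0 lef_pV2 ?posrE ?subr_gt0 ?expR_gt1//; last by lra.
  by rewrite lerB// ler_expR.
rewrite max_r; last by lra.
have := inv_expR_tangent v0 x0; have := @inv_expR_tangent R (d * v) x ltac:(lra) x0.
move: (expR x / _) => s.
move: (expR x - 1)^-1 (expR v - 1)^-1 (expR (d * v) - 1)^-1 => gx gv gd.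
move: (d * v) vdv xdv => w vw xw h1 h2.
rewrite mulrAC -lerBlDl ler_pdivlMr ?subr_gt0//.
by nra.
Qed.

(** [y / (y + 1)] and [1 / (y + 1)] lie between 0 and 1 and add up to 1; raising them to a power at
    least 1 only decreases them. *)
Lemma powR_superadditive (R : realType) (y d : R) : 0 < y -> 1 <= d ->
  y `^ d + 1 <= (y + 1) `^ d.
Proof.
move=> y0 d1; have y10 : 0 < y + 1 by lra.
have P := powR_gt0 d y10.
have fr z : 0 < z <= y + 1 -> z `^ d <= z / (y + 1) * (y + 1) `^ d.
  move=> /andP[z0 zy]; have z1 : 0 < z / (y + 1) <= 1.
    by rewrite divr_gt0//= ler_pdivrMr// mul1r.
  have -> : z `^ d = (z / (y + 1)) `^ d * (y + 1) `^ d.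
    by rewrite -powRM ?divfK ?lt0r_neq0 ?divr_ge0 ?(ltW z0) ?(ltW y10).
  by rewrite ler_wpM2r ?powR_ge0// ge1r_powR.
have := fr y ltac:(lra); have := fr 1 ltac:(lra); rewrite powR1 /=.
have e : y / (y + 1) + 1 / (y + 1) = 1 by rewrite -mulrDl divff ?lt0r_neq0.
by move: ((y + 1) `^ d) (y / (y + 1)) (1 / (y + 1)) e P => a b c e P h1 h2; nra.
Qed.

(** * The exponent [delta] and estimates for a single run *)

Lemma ln2_gt0 (R : realType) : 0 < ln 2 :> R.
Proof. by rewrite ln_gt0// ltr1n. Qed.

Lemma delta_gt1 (R : realType) : 1 < delta R.
Proof. by rewrite /delta ltr_pdivlMr ?ln2_gt0// mul1r ltr_ln ?posrE// ltr_nat. Qed.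

Lemma delta_le2 (R : realType) : delta R <= 2.
Proof.
rewrite /delta ler_pdivrMr ?ln2_gt0// mulr_natl -lnXn//.
by rewrite ler_ln ?posrE ?exprn_gt0// -natrX ler_nat.
Qed.

Lemma delta_ln2 (R : realType) : delta R * ln 2 = ln 3.
Proof. by rewrite /delta divfK// gt_eqF// ln2_gt0. Qed.

Definition log_succ (R : realType) (x : nat) : R := ln x.+1%:R.

Definition run_sum (R : realType) (x : nat) : R :=
  \sum_(j < ones x) (iter j collatz x)%:R^-1.

Lemma log_succE (R : realType) x :
  log_succ R x = ln (oddpart x)%:R + (ones x)%:R * ln 2.
Proof.
rewrite /log_succ succ_oddpart natrM natrX lnM ?posrE ?ltr0n ?oddpart_gt0 ?exprn_gt0//.
by rewrite lnXn// mulr_natl.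
Qed.

Lemma ones_le_log_succ (R : realType) x : (ones x)%:R * ln 2 <= log_succ R x.
Proof. by rewrite log_succE lerDr ln_ge0// ler1n oddpart_gt0. Qed.

(** With [x + 1 = a * 2 ^ k], [ln (peak x + 1)] is [ln a + delta * (k * ln 2)], at most
    [delta * ln (x + 1)] because [a >= 1]. The factor [r] records what halving gains. *)
Lemma log_succ_next (R : realType) x (r : R) : 0 < r ->
  r * (next_min x).+1%:R <= (peak x).+1%:R ->
  ln r + log_succ R (next_min x) <= delta R * log_succ R x.
Proof.
move=> r0 h; rewrite /log_succ -lnM ?posrE ?ltr0n//.
apply: (@le_trans _ _ (ln (peak x).+1%:R)).
  by rewrite ler_ln// posrE ?mulr_gt0 ?ltr0n.
have a1 : 0 <= ln (oddpart x)%:R :> R by rewrite ln_ge0// ler1n oddpart_gt0.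
rewrite -/(log_succ R x) log_succE succ_peak natrM natrX.
rewrite lnM ?posrE ?ltr0n ?oddpart_gt0 ?exprn_gt0// lnXn// -(delta_ln2 R).
rewrite -[_ *+ ones x]mulr_natl mulrDr [delta R * (_ * _)]mulrCA lerD2r.
by rewrite ler_peMl// ltW// delta_gt1.
Qed.

Lemma next_min_le_peak x : odd x -> (2 * next_min x <= peak x)%N.
Proof.
move=> ox; rewrite [leqRHS]peak_next leq_mul2r -{1}(expn1 2) leq_exp2l//.
by rewrite logn_peak_gt0// orbT.
Qed.

Lemma log_succ_next_le (R : realType) x : odd x ->
  log_succ R (next_min x) <= delta R * log_succ R x.
Proof.
move=> ox; have := @log_succ_next R x 1; rewrite ln1 add0r; apply=> //.
by rewrite mul1r ler_nat ltnS (leq_trans _ (next_min_le_peak ox))// leq_pmull.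
Qed.

(** The [j]-th odd element is at least [(3/2) ^ j * x], which leaves a geometric series. *)
Lemma run_sum_le (R : realType) x : (0 < x)%N ->
  run_sum R x <= 3 * (1 - (2 / 3) ^+ ones x) / x%:R.
Proof.
move=> x0; have xR : 0 < x%:R :> R by rewrite ltr0n.
have geo n : \sum_(j < n) (2 / 3 : R) ^+ j = 3 * (1 - (2 / 3) ^+ n).
  elim: n => [|n IH]; first by rewrite big_ord0 expr0 subrr mulr0.
  by rewrite big_ord_recr /= IH exprS; lra.
rewrite -geo mulr_suml; apply: ler_sum => j _.
have jk := ltnW (ltn_ord j).
have y0 : (0 < iter j collatz x)%N by apply: iter_collatz_gt0.
have := iter_onesM jk; have : (2 ^ j <= 3 ^ j)%N by case: (j : nat) => // i; rewrite leq_exp2r.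
move: (iter j collatz x) y0 => y y0 h23 e.
have {e h23} : (3 ^ j * x <= 2 ^ j * y)%N by lia.
rewrite -(ler_nat R) !natrM !natrX => h.
rewrite -[leLHS]mul1r ler_pdivrMr ?ltr0n// mulrAC ler_pdivlMr// mul1r.
rewrite expr_div_n mulrAC ler_pdivlMr ?exprn_gt0//.
by rewrite mulrC.
Qed.

Lemma next_min_eq x : odd x -> (logn 2 (peak x) <= 1)%N ->
  (3 ^ ones x * x <= 2 ^ ones x * (2 * next_min x))%N.
Proof.
move=> ox l1; have l0 := logn_peak_gt0 ox.
have pE : peak x = (2 * next_min x)%N.
  by rewrite {1}peak_next (_ : logn 2 (peak x) = 1%N)//; apply/eqP; rewrite eqn_leq l1.
have := iter_onesM (leqnn (ones x)); rewrite iter_ones_peak pE.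
have : (2 ^ ones x <= 3 ^ ones x)%N by rewrite leq_exp2r// ones_gt0.
by lia.
Qed.

Lemma run_sum_small (R : realType) x (k : nat) : (0 < x)%N -> (ones x <= k)%N ->
  run_sum R x <= 3 * (1 - (2 / 3) ^+ k) / x%:R.
Proof.
move=> x0 kk; apply: (le_trans (run_sum_le R x0)).
rewrite ler_pM2r ?invr_gt0 ?ltr0n// ler_pM2l// lerB// ler_wiXn2l//; lra.
Qed.

Lemma run_sum_le3 (R : realType) x : (0 < x)%N -> run_sum R x <= 3 / x%:R.
Proof.
move=> x0; apply: (le_trans (run_sum_le R x0)).
rewrite ler_pM2r ?invr_gt0 ?ltr0n// ger_pMr// gerBl exprn_ge0//; lra.
Qed.

(** * Pairing heavy runs *)

Lemma local_min_gt X0 A x : collatz_verified X0 -> nontrivial_cycle A ->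
  x \in local_mins A -> (X0 < x)%N.
Proof.
move=> ver ntA xM; have xA := local_min_mem xM.
have [pA _ _] := collatz_cycleP ntA.1.
exact: (reach_cycle_gt (j := 0) ver ntA (pA _ xA)).
Qed.

Lemma small_min_halves_once X0 A x : collatz_verified X0 -> nontrivial_cycle A ->
  x \in local_mins A -> (x <= 2 * X0)%N -> (logn 2 (peak x) <= 1)%N.
Proof.
move=> ver ntA xM xX; rewrite leqNgt; apply/negP => /(halve_twice_gt ver ntA xM).
by rewrite ltnNge xX.
Qed.

Lemma peak_next1 x : odd x -> (logn 2 (peak x) <= 1)%N ->
  peak x = (2 * next_min x)%N.
Proof.
move=> /logn_peak_gt0 l0 l1; rewrite {1}peak_next (_ : logn 2 (peak x) = 1%N)//.
by apply/eqP; rewrite eqn_leq l1.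
Qed.

Lemma next_min_double x : odd x -> (logn 2 (peak x) <= 1)%N ->
  (2 ^ ones x * (2 * next_min x).+1 = 3 ^ ones x * x.+1)%N.
Proof. by move=> ox l1; rewrite -peak_next1// -iter_ones_peak iter_onesM. Qed.

Lemma inv_next_min (R : realFieldType) x (k : nat) : (0 < x)%N -> odd x ->
  (logn 2 (peak x) <= 1)%N -> (k <= ones x)%N ->
  (next_min x)%:R^-1 <= 2 * (2 / 3) ^+ k * x%:R^-1 :> R.
Proof.
move=> x0 ox l1 kx.
have y0 : (0 < next_min x)%N by case: (next_min x) (next_min_odd ox).
have : (2 / 3 : R) ^+ ones x <= (2 / 3) ^+ k by rewrite ler_wiXn2l//; lra.
suff : (next_min x)%:R^-1 <= 2 * (2 / 3) ^+ ones x * x%:R^-1 :> R.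
  move=> h1 h2; apply: (le_trans h1); rewrite ler_pM2r ?invr_gt0 ?ltr0n//.
  by rewrite ler_pM2l.
have := next_min_eq ox l1; rewrite -(ler_nat R) !natrM !natrX => h.
rewrite expr_div_n -[leLHS]mul1r ler_pdivrMr ?ltr0n// mulrAC ler_pdivlMr ?ltr0n// mul1r.
by rewrite mulrAC mulrA ler_pdivlMr ?exprn_gt0//; lra.
Qed.

(** 97/54 is half of [3 * (1 + (2/3) ^ 4)], the worst total, relative to [1 / X0], of a once-halved
    run of at least four odd steps and its successor. At [x = 162/97 * X0] the crude bound [3 / x]
    equals [mean_bound]. *)
Definition mean_bound (R : realFieldType) (X0 : nat) : R := 97 / (54 * X0%:R).

Lemma mean_boundE (R : realFieldType) (X0 : nat) :
  mean_bound R X0 = 97 / 54 * X0%:R^-1.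
Proof. by rewrite /mean_bound invfM mulrA. Qed.

(** At most two odd steps give a sum of at most [(5/3) / x], and a double halving forces
    [2 * X0 < x], hence at most [(3/2) / X0]; both stay below 97/54 over [X0]. *)
Lemma heavy_run (R : realType) X0 A x : (0 < X0)%N -> collatz_verified X0 ->
  nontrivial_cycle A -> x \in local_mins A -> mean_bound R X0 < run_sum R x ->
  [/\ (3 <= ones x)%N, (logn 2 (peak x) <= 1)%N
    & log_succ R x < ln (162 / 97 * X0%:R)].
Proof.
move=> X00 ver ntA xM; rewrite mean_boundE => hx.
have Xx := local_min_gt ver ntA xM.
have x0 : (0 < x)%N by apply: leq_trans Xx.
have XR : 0 < X0%:R :> R by rewrite ltr0n.
have xR : 0 < x%:R :> R by rewrite ltr0n.
have XxR : X0%:R < x%:R :> R by rewrite ltr_nat.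
have xXi : x%:R^-1 < X0%:R^-1 :> R by rewrite ltf_pV2.
have xi : 0 < x%:R^-1 :> R by rewrite invr_gt0.
have k3 : (3 <= ones x)%N.
  rewrite leqNgt; apply/negP => k2.
  have := @run_sum_small R x 2 x0 k2; rewrite expr2; lra.
have l1 : (logn 2 (peak x) <= 1)%N.
  apply: (small_min_halves_once ver ntA xM); rewrite leqNgt; apply/negP => xX.
  have := run_sum_le3 R x0.
  have : x%:R^-1 < (2 * X0%:R)^-1 :> R by rewrite ltf_pV2 ?posrE ?mulr_gt0// -natrM ltr_nat.
  by rewrite invfM; lra.
split=> //; rewrite /log_succ ltr_ln ?posrE ?ltr0n ?mulr_gt0 ?divr_gt0//.
have k2x : 2 ^+ ones x <= x%:R + 1 :> R.
  rewrite natr1 -natrX ler_nat [leqRHS]succ_oddpart leq_pmull// oddpart_gt0//.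
have r34 : (3 / 4) ^+ ones x <= 27 / 64 :> R.
  apply: (@le_trans _ _ ((3 / 4) ^+ 3)); first by rewrite ler_wiXn2l//; lra.
  by rewrite !exprS expr0; lra.
have e1 : (3 / 4) ^+ ones x * 2 ^+ ones x * (2 / 3) ^+ ones x = 1 :> R.
  rewrite -!exprMn (_ : 3 / 4 * 2 * (2 / 3) = 1) ?expr1n//; lra.
have := run_sum_le R x0.
have r0 : 0 < (2 / 3) ^+ ones x :> R by rewrite exprn_gt0//; lra.
have p0 : 0 < (3 / 4) ^+ ones x :> R by rewrite exprn_gt0//; lra.
have q0 : 0 < 2 ^+ ones x :> R by rewrite exprn_gt0//; lra.
rewrite -[x.+1%:R]natr1.
move: ((2 / 3) ^+ ones x) ((3 / 4) ^+ ones x) (2 ^+ ones x) k2x r34 e1 r0 p0 q0.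
move=> r p q qx p27 e1 r0 p0 q0 hS.
have {}hx : 97 / 54 * X0%:R^-1 < 3 * (1 - r) / x%:R by exact: lt_le_trans hx hS.
have {}hx : x%:R < 162 / 97 * X0%:R * (1 - r).
  move: hx; rewrite ltr_pdivlMr// mulrAC ltr_pdivrMr//; lra.
set V := 162 / 97 * X0%:R in hx *.
have X1 : 1 <= X0%:R :> R by rewrite ler1n.
have V1 : 1 <= V by rewrite /V; lra.
(* The margin [r * V] in [x < V * (1 - r)] pays for the [+ 1] in [log_succ]: [1 = p * q * r] with
   [q <= x + 1]. *)
have rV : 1 <= r * V.
  rewrite -{1}e1 mulrC ler_pM2l//.
  have : p * q <= 27 / 64 * (x%:R + 1) by apply: ler_pM => //; exact: ltW.
  by nra.
by lra.
Qed.

(* With exactly three odd steps the next run may be too heavy to compensate;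
   then it is itself halved only once and the run after it is light enough. *)
Definition partner (X0 x : nat) : nat :=
  if [&& ones x == 3, 3 <= ones (next_min x) & next_min x <= 2 * X0]%N
  then next_min (next_min x) else next_min x.

(** Three odd steps and one halving give [next_min x >= 27/16 * x], and [3 * 16/27 = 96/54] is just
    below 97/54. So no two consecutive runs are heavy. *)
Lemma heavy_next (R : realType) X0 A x : (0 < X0)%N -> collatz_verified X0 ->
  nontrivial_cycle A -> x \in local_mins A -> mean_bound R X0 < run_sum R x ->
  run_sum R (next_min x) <= mean_bound R X0.
Proof.
move=> X00 ver ntA xM hx; have [k3 l1 _] := heavy_run X00 ver ntA xM hx.
have Xx := local_min_gt ver ntA xM; have x0 : (0 < x)%N by apply: leq_trans Xx.
have ox := local_min_odd ntA.1 xM.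
have y0 : (0 < next_min x)%N by case: (next_min x) (next_min_odd ox).
have := @inv_next_min R x 3 x0 ox l1 k3; rewrite !exprS expr0 mean_boundE.
have xXi : x%:R^-1 < X0%:R^-1 :> R by rewrite ltf_pV2 ?posrE ?ltr0n// ltr_nat.
have : 0 < X0%:R^-1 :> R by rewrite invr_gt0 ltr0n.
have := run_sum_le3 R y0.
by lra.
Qed.

Lemma partnerP (R : realType) X0 A x : (765 < X0)%N -> collatz_verified X0 ->
  nontrivial_cycle A -> x \in local_mins A -> mean_bound R X0 < run_sum R x ->
  [/\ run_sum R (partner X0 x) <= mean_bound R X0,
      run_sum R x + run_sum R (partner X0 x) <= 2 * mean_bound R X0
    & log_succ R (partner X0 x) <= delta R * ln (162 / 97 * X0%:R)].
Proof.
move=> X765 ver ntA xM hx; have X00 : (0 < X0)%N by apply: leq_trans X765.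
have [k3 l1 ux] := heavy_run X00 ver ntA xM hx; have cA := ntA.1.
have Xx := local_min_gt ver ntA xM; have x0 : (0 < x)%N by apply: leq_trans Xx.
have ox := local_min_odd cA xM.
have yM := next_min_local cA xM; have oy := local_min_odd cA yM.
have y0 : (0 < next_min x)%N by case: (next_min x) oy.
have xXi : x%:R^-1 < X0%:R^-1 :> R by rewrite ltf_pV2 ?posrE ?ltr0n// ltr_nat.
have XR : 765 < X0%:R :> R by rewrite ltr_nat.
have xi : 0 < x%:R^-1 :> R by rewrite invr_gt0 ltr0n.
have d0 : 0 < delta R by rewrite (lt_trans ltr01)// delta_gt1.
have Sx := run_sum_le R x0; have Sy := run_sum_le3 R y0.
have hy := heavy_next X00 ver ntA xM hx.
have uy : log_succ R (next_min x) <= delta R * ln (162 / 97 * X0%:R).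
  by rewrite (le_trans (log_succ_next_le R ox))// ler_pM2l// ltW.
have [/eqP k3e|k3n] := boolP (ones x == 3)%N; last first.
  have -> : partner X0 x = next_min x by rewrite /partner (negPf k3n).
  have k4 : (4 <= ones x)%N by rewrite ltn_neqAle eq_sym k3n.
  split=> //; rewrite mean_boundE.
  have yi := inv_next_min R x0 ox l1 (leqnn _).
  have : (2 / 3) ^+ ones x <= (2 / 3) ^+ 4 :> R by rewrite ler_wiXn2l//; lra.
  rewrite !exprS expr0.
  move: ((2 / 3) ^+ ones x) Sx yi => r Sx yi hr.
  have : r * x%:R^-1 <= 16 / 81 * x%:R^-1 by rewrite ler_pM2r//; lra.
  by lra.
have yi := @inv_next_min R x 3 x0 ox l1 k3.
rewrite k3e in Sx; rewrite !exprS expr0 in Sx yi.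
have [k2|k3'] := ltnP (ones (next_min x)) 3.
  have -> : partner X0 x = next_min x by rewrite /partner [(3 <= _)%N]leqNgt k2 andbF.
  split=> //; rewrite mean_boundE.
  by have := @run_sum_small R _ 2 y0 k2; rewrite !exprS expr0; lra.
(* If [next_min x] exceeds [2 * X0], then [x >= 31/27 * X0], and the two sums are at most 57/31 and
   3/2 over [X0]. *)
have [yX|Xy] := leqP (next_min x) (2 * X0); last first.
  have -> : partner X0 x = next_min x by rewrite /partner [(_ <= 2 * X0)%N]leqNgt Xy !andbF.
  split=> //; rewrite mean_boundE.
  have e := next_min_double ox l1; rewrite k3e -[(2 ^ 3)%N]/8%N -[(3 ^ 3)%N]/27%N in e.
  have : (32 * X0 <= 27 * x + 3)%N by clear - Xy e; lia.
  rewrite -(ler_nat R) natrD !natrM => h.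
  have : x%:R^-1 <= 27 / 31 * X0%:R^-1 :> R.
    rewrite -[leLHS]mul1r ler_pdivrMr ?ltr0n// mulrAC ler_pdivlMr; lra.
  have : (next_min x)%:R^-1 <= (2 * X0%:R)^-1 :> R.
    by rewrite lef_pV2 ?posrE ?ltr0n ?mulr_gt0 ?ltr0n// -natrM ler_nat ltnW.
  by rewrite invfM; lra.
have -> : partner X0 x = next_min (next_min x) by rewrite /partner k3e k3' yX.
have l1y := small_min_halves_once ver ntA yM yX.
have z0 : (0 < next_min (next_min x))%N by case: (next_min (next_min x)) (next_min_odd oy).
have zM := next_min_local cA yM; have Xz := local_min_gt ver ntA zM.
have zi := @inv_next_min R _ 3 y0 oy l1y k3'; rewrite !exprS expr0 in zi.
have Sz := run_sum_le3 R z0.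
split; rewrite ?mean_boundE; [lra..|].
(* Two applications of the growth bound would cost [delta ^ 2]. Instead [next_min x <= 2 * X0] keeps
   its logarithm within [ln (5/4)] of the threshold, and the single halving gains 27/14, more than
   [(5/4) ^ 2], which suffices since [delta <= 2]. *)
have hz : ln (27 / 14) + log_succ R (next_min (next_min x)) <=
    delta R * log_succ R (next_min x).
  apply: log_succ_next; first by lra.
  have : X0%:R < (next_min (next_min x))%:R :> R by rewrite ltr_nat.
  by rewrite (peak_next1 oy l1y) -[(next_min _).+1%:R]natr1 -[(2 * _).+1%:R]natr1 natrM; lra.
have V0 : 0 < 162 / 97 * X0%:R :> R by lra.
have uy' : log_succ R (next_min x) <= ln (5 / 4) + ln (162 / 97 * X0%:R).
  rewrite -lnM ?posrE; [|lra..].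
  rewrite /log_succ ler_ln ?posrE ?ltr0n//; [|lra..].
  by move: yX; rewrite -(ler_nat R) natrM -[(next_min x).+1%:R]natr1; lra.
have l54 : 0 <= ln (5 / 4) :> R by rewrite ln_ge0//; lra.
have l2 : 2 * ln (5 / 4) <= ln (27 / 14) :> R.
  rewrite mulr_natl -lnXn; last by lra.
  by rewrite expr2 ler_ln ?posrE; lra.
have := ler_wpM2l (ltW d0) uy'; rewrite mulrDr.
have := ler_wpM2r l54 (delta_le2 R).
by lra.
Qed.

(** * From cycles to sums of inverses *)

(** Every odd element lies on some run, and for [phi >= 0] such a covering is enough. *)
Lemma sum_odd_le_runs (R : realFieldType) A (phi : nat -> R) :
  collatz_cycle A -> (forall y, 0 <= phi y) ->
  \sum_(y <- odd_elements A) phi y <=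
  \sum_(x : local_mins A) \sum_(j < ones (val x)) phi (iter j collatz (val x)).
Proof.
move=> cA phi0.
apply: (@le_trans _ _ (\sum_(y <- odd_elements A) \sum_(x : local_mins A)
    \sum_(j < ones (val x) | iter j collatz (val x) == y) phi y)).
  rewrite big_seq [leRHS]big_seq; apply: ler_sum => y.
  rewrite !inE => /andP[yA oy]; have [x xM [j jk <-]] := odd_in_run cA yA oy.
  rewrite (bigD1 [` xM]%fset)//= (bigD1 (Ordinal jk))//= -addrA lerDl addr_ge0//.
    exact: sumr_ge0.
  by apply: sumr_ge0 => x' _; apply: sumr_ge0.
rewrite exchange_big /=; apply: ler_sum => x _.
under eq_bigr do rewrite big_mkcond /=.
rewrite exchange_big /=; apply: ler_sum => j _.
rewrite -big_mkcond /= -big_filter.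
set z := iter _ _ _; rewrite (eq_filter (a2 := pred1 z)) => [|y]; last by rewrite /= eq_sym.
have [zO|zO] := boolP (z \in (odd_elements A : seq nat)).
  by rewrite filter_pred1_uniq ?fset_uniq// big_seq1.
rewrite big_filter big1_seq ?phi0// => y /andP[/eqP -> zO'].
by rewrite zO' in zO.
Qed.

Lemma odd_count_le (R : realType) A : collatz_cycle A ->
  #|` odd_elements A|%:R * ln 2 <= \sum_(x : local_mins A) log_succ R (val x).
Proof.
move=> cA; have := @sum_odd_le_runs R A (fun=> ln 2) cA (fun=> ltW (ln2_gt0 R)).
rewrite big_const_seq iter_addr addr0 count_predT -[ln 2 *+ _]mulr_natl => /le_trans; apply.
apply: ler_sum => x _; rewrite sumr_const card_ord -[ln 2 *+ _]mulr_natl.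
exact: ones_le_log_succ.
Qed.

Lemma odd_elements_perm A : perm_eq (odd_elements A) [seq x <- A | odd x].
Proof.
apply: uniq_perm; rewrite ?filter_uniq ?fset_uniq// => x.
by rewrite mem_filter !inE andbC.
Qed.

Lemma even_elements_perm A : perm_eq (even_elements A) [seq x <- A | ~~ odd x].
Proof.
apply: uniq_perm; rewrite ?filter_uniq ?fset_uniq// => x.
by rewrite mem_filter !inE andbC.
Qed.

Lemma card_cycle A :
  (#|` odd_elements A| + #|` even_elements A|)%N = size A.
Proof.
rewrite (perm_size (odd_elements_perm A)) (perm_size (even_elements_perm A)).
by rewrite !size_filter count_predC.
Qed.

Lemma collatz_perm A : collatz_cycle A -> perm_eq (map collatz A) A.
Proof.
move=> cA; have [_ iA _] := collatz_cycleP cA.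
have uC : uniq (map collatz A).
  by rewrite map_inj_in_uniq ?fset_uniq//; apply: collatz_cycle_inj.
have sub : {subset map collatz A <= A}.
  by move=> _ /mapP[x xA ->]; apply: (iA x 1).
apply: uniq_perm => //; first exact: fset_uniq.
by have [|_ h] := uniq_min_size uC sub; rewrite ?size_map.
Qed.

(* The product of [collatz x / x] over a cycle is 1. *)
Lemma cycle_log_identity (R : realType) A : collatz_cycle A ->
  (#|` odd_elements A|%:R + #|` even_elements A|%:R) * ln 2 =
  \sum_(y <- odd_elements A) ln (3 + y%:R^-1) :> R.
Proof.
move=> cA; have [pA _ _] := collatz_cycleP cA.
rewrite -natrD card_cycle (perm_big _ (odd_elements_perm A)) big_filter big_mkcond /=.
have e : \sum_(y <- map collatz A) ln y%:R = \sum_(y <- A) ln y%:R :> R.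
  exact: perm_big (collatz_perm cA).
have : \sum_(y <- A) (ln (collatz y)%:R - ln y%:R) = 0 :> R.
  by rewrite sumrB -e big_map subrr.
rewrite (eq_big_seq (fun y => (if odd y then ln (3 + y%:R^-1) else 0) - ln 2)).
  rewrite sumrB [X in _ - X]big_const_seq iter_addr addr0 count_predT.
  by rewrite mulr_natl => /subr0_eq.
move=> y /pA y0; have yR : 0 < y%:R :> R by rewrite ltr0n.
have c0 : 0 < (collatz y)%:R :> R by rewrite ltr0n (iter_collatz_gt0 1 y0).
apply/eqP; rewrite subr_eq addrAC eq_sym subr_eq; apply/eqP.
have -> : ln (collatz y)%:R + ln 2 = ln (2 * collatz y)%:R :> R.
  by rewrite natrM lnM ?posrE// addrC.
case: ifPn => [/collatz_oddE|/collatz_evenE] ->; last by rewrite add0r.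
rewrite -lnM ?posrE ?addr_gt0 ?invr_gt0// natrD natrM mulrDl mulVf ?gt_eqF//.
Qed.

(** [cycle_log_identity] divided by [K * ln 2] leaves the sum of [ln (1 + 1 / (3 y))], whose terms
    lie strictly between 0 and [1 / (3 y)]; as there is an odd element, strictness survives
    summation. *)
Lemma cycle_ratio_bounds (R : realType) A (E : R) : collatz_cycle A ->
  (0 < #|` odd_elements A|)%N ->
  \sum_(y <- odd_elements A) y%:R^-1 <= E ->
  delta R < (#|` odd_elements A|%:R + #|` even_elements A|%:R)
      / #|` odd_elements A|%:R
    < delta R + 1 / (#|` odd_elements A|%:R * (3 * ln 2)) * E.
Proof.
move=> cA K0 hE; have [pA _ _] := collatz_cycleP cA.
set K : R := #|` odd_elements A|%:R.
have KR : 0 < K by rewrite ltr0n.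
have l2 := ln2_gt0 R.
have splitE y : (0 < y)%N -> ln (3 + y%:R^-1) = ln 3 + ln (1 + (3 * y%:R)^-1) :> R.
  move=> y0; have yR : 0 < y%:R :> R by rewrite ltr0n.
  rewrite -lnM ?posrE ?addr_gt0 ?invr_gt0 ?mulr_gt0//; congr ln.
  by field; rewrite gt_eqF.
have := cycle_log_identity R cA; rewrite -/K big_seq.
have oE y : y \in odd_elements A -> (0 < y)%N by rewrite !inE => /andP[/pA].
rewrite (eq_bigr _ (fun y yO => splitE y (oE y yO))) -big_seq big_split /=.
rewrite big_const_seq iter_addr addr0 count_predT -[ln 3 *+ _]mulr_natl -/K -delta_ln2.
set W := \sum_(_ <- _) ln _ => eqW.
have term z : (0 < z)%N ->
    0 < (ln (1 + (3 * z%:R)^-1) : R) < (3^-1 * z%:R^-1 : R).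
  move=> z0; have i0 : 0 < (3 * z%:R)^-1 :> R by rewrite invr_gt0 mulr_gt0 ?ltr0n.
  apply/andP; split; first by apply: ln_gt0; rewrite ltrDl.
  have -> : 3^-1 * z%:R^-1 = (3 * z%:R)^-1 :> R by rewrite invfM.
  move: (3 * z%:R)^-1 i0 => w w0.
  have w1 : 1 + w \is Num.pos by rewrite posrE addr_gt0.
  by rewrite -ltr_expR lnK//; apply: expR_gt1Dx; rewrite gt_eqF.
have [W0 WE] : 0 < W /\ W < 3^-1 * E.
  have {}oE y : y \in enum_fset (odd_elements A) -> (0 < y)%N by exact: oE.
  rewrite /W; move: K0 hE oE.
  case: (enum_fset _) => // y s _ hE oE.
  have /andP[y1 y2] := term y (oE y (mem_head _ _)).
  have sE z : z \in s -> (0 < z)%N by move=> zs; apply: oE; rewrite inE zs orbT.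
  rewrite big_cons; split.
    rewrite ltr_wpDr// big_seq; apply: sumr_ge0 => z zs.
    by have /andP[/ltW] := term z (sE z zs).
  apply: lt_le_trans (_ : 3^-1 * \sum_(z <- y :: s) z%:R^-1 <= _); last first.
    by rewrite ler_pM2l// invr_gt0.
  rewrite big_cons mulrDr ltr_leD// mulr_sumr big_seq [leRHS]big_seq.
  by apply: ler_sum => z zs; have /andP[_ /ltW] := term z (sE z zs).
have Kl : 0 < K * ln 2 by rewrite mulr_gt0.
have -> : (K + #|` even_elements A|%:R) / K = delta R + W / (K * ln 2).
  have -> : W = (K + #|` even_elements A|%:R) * ln 2 - K * (delta R * ln 2).
    by rewrite eqW addrAC subrr add0r.
  by field; rewrite !gt_eqF.
have -> : 1 / (K * (3 * ln 2)) * E = 3^-1 * E / (K * ln 2).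
  by field; rewrite !gt_eqF.
by rewrite ltrDl divr_gt0//= ltrD2l ltr_pM2r// invr_gt0.
Qed.

(** Following [next_min] from [x] to [y], the first value of [u] above [t] comes right after one
    that is at most [t]. *)
Lemma local_min_ratio_linked (R : realType) A (v0 : R) : collatz_cycle A ->
  ratio_linked (fun x : local_mins A => log_succ R (val x)) [set: local_mins A]
    (delta R) v0.
Proof.
move=> cA t [x xM] [y yM] _ _ _ /= xt ty.
have [q qy] := next_min_connect cA xM yM.
elim: q x xM xt qy => [|q IH] x xM xt; first by move=> /= e; move: ty; rewrite -e ltNge xt.
rewrite iterSr => qy; have [nt|tn] := leP (log_succ R (next_min x)) t.
  exact: IH (next_min_local cA xM) nt qy.
exists [` next_min_local cA xM]%fset; first exact: finset.in_setT.
apply/andP; split; first exact: tn.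
apply: (le_trans (log_succ_next_le R (local_min_odd cA xM))).
by rewrite ler_pM2l// (lt_trans ltr01)// delta_gt1.
Qed.

(** * Injectivity of partners within a cycle, and the three bounds *)

Local Open Scope fset_scope.
Local Open Scope ring_scope.

Lemma partner_local X0 A x : collatz_cycle A -> x \in local_mins A ->
  partner X0 x \in local_mins A.
Proof. by move=> cA xM; rewrite /partner; case: ifP => _; rewrite ?next_min_local. Qed.

(** If equal partners were reached in different numbers of steps, one heavy run would directly
    follow another, which [heavy_next] excludes. *)
Lemma partner_inj (R : realType) X0 A x y : (0 < X0)%N -> collatz_verified X0 ->
  nontrivial_cycle A -> x \in local_mins A -> y \in local_mins A ->
  mean_bound R X0 < run_sum R x -> mean_bound R X0 < run_sum R y ->
  partner X0 x = partner X0 y -> x = y.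
Proof.
move=> X00 ver ntA xM yM hx hy; have cA := ntA.1.
have inj := next_min_inj cA; have nM := next_min_local cA.
rewrite /partner; case: ifP => _; case: ifP => _.
- by move/(inj _ _ (nM _ xM) (nM _ yM)); apply: inj.
- move/(inj _ _ (nM _ xM) yM) => e.
  by have := heavy_next X00 ver ntA xM hx; rewrite e leNgt hy.
- move/(inj _ _ xM (nM _ yM)) => e.
  by have := heavy_next X00 ver ntA yM hy; rewrite -e leNgt hx.
- exact: inj.
Qed.

Theorem theorem21 (R : realType) (X0 : nat) (hX0 : (765 < X0)%N)
    (hver : collatz_verified X0)
    (A : {fset nat}) (m K L m2 : nat) (v : R)
    (hA : m_cycle m A)
    (hK : K = #|` odd_elements A|)
    (hL : L = #|` even_elements A|)
    (hm2_pos : (0 < m2)%N) (hm2_le : (m2 <= m)%N)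
    (hbound :
       (delta R ^+ m2 - 1) / (delta R - 1)
         * (ln (162 / 97 * X0%:R) / ln 2)
       <= m2%:R / m%:R * K%:R)
    (hv : v = m2%:R / m%:R * K%:R * ((delta R - 1) / (delta R ^+ m2 - 1))) :
  [/\ delta R < (K%:R + L%:R) / K%:R
        < delta R + 1 / (K%:R * (3 * ln 2))
            * ((97 * (m%:R - m2%:R) + 73) / (54 * X0%:R)
               + 3 / (2 `^ v - 1)
               + 3 * (m2%:R - 1) / (2 `^ v - 1) `^ delta R),
      m2 = (m - 1)%N ->
      delta R < (K%:R + L%:R) / K%:R
        < delta R + 1 / (K%:R * (3 * ln 2))
            * (3 / X0%:R
               + 3 / (2 `^ v - 1)
               + 3 * (m%:R - 2) / (2 `^ v - 1) `^ delta R)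
    & m2 = m ->
      delta R < (K%:R + L%:R) / K%:R
        < delta R + 1 / (K%:R * (3 * ln 2))
            * (3 / (2 `^ v - 1)
               + 3 * (m%:R - 1) / (2 `^ v - 1) `^ delta R)].
Proof.
have [ntA cardM] := hA; have cA := ntA.1.
have d1 := delta_gt1 R; have l2 := ln2_gt0 R.
have X00 : (0 < X0)%N by apply: leq_trans hX0.
have XR : 765 < X0%:R :> R by rewrite ltr_nat.
have m0 : (0 < m)%N by apply: leq_trans hm2_le.
have mR : 0 < m%:R :> R by rewrite ltr0n.
have m2R : 1 <= m2%:R :> R by rewrite ler1n.
pose I : finType := local_mins A.
have cI : #|I| = m by rewrite -cardM cardfE.
have K0 : (0 < #|` odd_elements A|)%N.
  have /card_gt0P[x _] : (0 < #|I|)%N by rewrite cI.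
  have xM := valP x; rewrite cardfs_gt0; apply/fset0Pn; exists (val x).
  by rewrite !inE (local_min_mem xM) (local_min_odd cA xM).
pose u (x : I) := log_succ R (val x).
pose S (x : I) := run_sum R (val x).
pose g (t : R) := 3 * (expR t - 1)^-1.
set G := \sum_(j < m2) delta R ^+ j.
have GE : (delta R ^+ m2 - 1) / (delta R - 1) = G.
  by rewrite subrX1 mulrAC divff ?mul1r// lt0r_neq0// subr_gt0.
have G0 : 0 < G.
  by rewrite /G; case: (m2) hm2_pos => // n _; rewrite big_ord_recl expr0 ltr_pwDl//
    sumr_ge0// => i _; rewrite exprn_ge0// ltW// (lt_trans ltr01).
pose v0 : R := ln (162 / 97 * X0%:R).
have v00 : 0 < v0 by rewrite ln_gt0//; lra.
(* [w] starts the progression of ratio [delta] whose [m2] terms sum to the share [m2 / m] of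
   [K * ln 2]; [hbound] says exactly that [v0 <= w]. *)
pose w := v * ln 2.
have wG : w * G = m2%:R / m%:R * K%:R * ln 2.
  rewrite /w hv -[_ / (delta R ^+ m2 - 1)]invf_div GE mulrAC divfK ?lt0r_neq0//.
have v0w : v0 <= w.
  move: hbound; rewrite GE mulrA ler_pdivrMr// => h.
  by rewrite -(ler_pM2r G0) wG [v0 * G]mulrC.
have w0 : 0 < w by apply: lt_le_trans v0w.
have wdw : w < delta R * w by rewrite ltr_pMl.
have dw0 : 0 < delta R * w by apply: lt_trans wdw.
have expw : expR w = 2 `^ v by rewrite /w /powR pnatr_eq0.
have y0 : 0 < 2 `^ v - 1 by rewrite -expw subr_gt0 expR_gt1.
(* [- lam] is the slope of the chord of [g] between [w] and [delta * w]. *)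
pose gd := g (delta R * w); pose lam := (g w - gd) / (delta R * w - w).
have gw : g w = 3 / (2 `^ v - 1) by rewrite /g expw.
have gdle : gd <= 3 / (2 `^ v - 1) `^ delta R.
  rewrite /gd /g ler_pM2l// lef_pV2 ?posrE; first last.
  - by rewrite powR_gt0.
  - by rewrite subr_gt0 expR_gt1.
  rewrite [delta R * w]mulrC expRM expw lerBrDr.
  by have := powR_superadditive y0 (ltW d1); rewrite subrK.
have gdw : gd <= g w.
  rewrite /gd /g ler_pM2l// lef_pV2 ?posrE ?subr_gt0 ?expR_gt1//.
  by rewrite lerB// ler_expR ltW.
have lam0 : 0 <= lam by apply: divr_ge0; rewrite subr_ge0; [exact: gdw|exact: ltW].
have gP x : w <= x -> g x <= gd + lam * Num.max 0 (delta R * w - x).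
  move=> wx; have : g x <= 3 * _ := ler_wpM2l (ler0n R 3) (inv_expR_chord w0 d1 wx).
  by congr (_ <= _); rewrite /lam /gd /g; ring.
(* The chord correction turns one [gd] into [g w], leaving [g w + (m2 - 1) * gd]. *)
have total : m2%:R * gd + lam * (delta R * w - w) <=
    3 / (2 `^ v - 1) + 3 * (m2%:R - 1) / (2 `^ v - 1) `^ delta R.
  rewrite /lam divfK ?lt0r_neq0 ?subr_gt0// -gw.
  have : (m2%:R - 1) * gd <= (m2%:R - 1) * (3 / (2 `^ v - 1) `^ delta R).
    by apply: ler_wpM2l => //; rewrite subr_ge0.
  by lra.
have xX (x : I) : (X0 < val x)%N by apply: (local_min_gt hver ntA (valP x)).
have Sg x : S x <= g (u x).
  have x0 : (0 < val x)%N by apply: leq_ltn_trans (xX x).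
  rewrite /g /u /log_succ lnK ?posrE ?ltr0n// -[(val x).+1%:R]natr1 addrK; exact: run_sum_le3.
have SX x : S x <= 3 / X0%:R.
  have x0 : (0 < val x)%N by apply: leq_ltn_trans (xX x).
  apply: (le_trans (run_sum_le3 R x0)).
  by rewrite ler_pM2l// lef_pV2 ?posrE ?ltr0n// ler_nat ltnW.
have rl : ratio_linked u [set: I] (delta R) v0 by apply: local_min_ratio_linked.
have sumu : #|I|%:R * (w * G) <= m2%:R * \sum_x u x.
  rewrite wG cI -!mulrA mulrCA [m%:R * _]mulrA divff ?lt0r_neq0// mul1r.
  by rewrite ler_wpM2l// hK; apply: odd_count_le.
have nI : (m2 <= #|I|)%N by rewrite cI.
have oddS : \sum_(y <- odd_elements A) y%:R^-1 <= \sum_x S x.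
  by apply: sum_odd_le_runs => // y; rewrite invr_ge0 ler0n.
have concl E : \sum_x S x <= E ->
    delta R < (K%:R + L%:R) / K%:R < delta R + 1 / (K%:R * (3 * ln 2)) * E.
  by move=> hE; rewrite hK hL; apply: cycle_ratio_bounds => //; apply: le_trans hE.
have top := top_sum_bound hm2_pos nI d1 v00 v0w lam0 rl sumu gP Sg SX.
rewrite cI in top.
split.
- apply: concl.
  have memp (x : I) : partner X0 (val x) \in local_mins A by apply: partner_local (valP x).
  pose p (x : I) : I := [` memp x].
  have DP x : (x \in [set z | mean_bound R X0 < S z]%SET) = (mean_bound R X0 < S x) by rewrite inE.
  have := @paired_sum_bound R I u S p m2 (delta R) v0 w lam gd (mean_bound R X0)
    (73 / 54 * X0%:R^-1) g hm2_pos nI d1 v00 v0w lam0 rl sumu gP Sg.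
  have iX : 0 < X0%:R^-1 :> R by rewrite invr_gt0; lra.
  have ee := mean_boundE R X0.
  have PP x : mean_bound R X0 < S x -> _ := partnerP hX0 hver ntA (valP x).
  rewrite cI => H; apply: (le_trans (H _ _ _ _ _ _ _)).
  + by rewrite mulr_ge0//; lra.
  (* [S x <= 3 / X0], and [3 = 162/54] is below [97/54 + 73/54]. *)
  + by move=> x; apply: (le_trans (SX x)); rewrite ee; lra.
  + move=> x y; rewrite !DP => hx hy /(congr1 val) /= e; apply: val_inj.
    exact: (partner_inj X00 hver ntA (valP x) (valP y) hx hy e).
  + by move=> x; rewrite !DP => /PP[h _ _]; rewrite -leNgt.
  + by move=> x; rewrite !DP => /PP[_ h _].
  + by move=> x; rewrite !DP => h; have [] := heavy_run X00 hver ntA (valP x) h.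
  + by move=> x; rewrite !DP => /PP[_ _ h].
  by rewrite -[leRHS]addrA lerD// ee invfM; lra.
- move=> e; apply: concl; apply: (le_trans top).
  (* Exactly one run lies outside the top [m2], bounded by [3 / X0]. *)
  have -> : m%:R = m2%:R + 1 :> R by rewrite natr1 e subn1 prednK.
  by move: total; lra.
- by move=> e; apply: concl; apply: (le_trans top); rewrite -e subrr mul0r add0r.
Qed.
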